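(* Let $\lambda$ be an uncountable cardinal which is not the successor of a regular cardinal. If $\square_\lambda+\mathsf{CH}_\lambda$ holds, then $\diamondsuit\square^\Gamma_\lambda$ holds for some $\Gamma\subseteq\operatorname{reg}(\lambda)$ which is cofinal in $\operatorname{reg}(\lambda)$ (i.e. $\sup\Gamma=\sup\operatorname{reg}(\lambda)$).
   Context: $\operatorname{acc}(A)=\{\alpha\in A:\sup(A\cap\alpha)=\alpha\}$ for a set of ordinals $A$. $\operatorname{reg}(\lambda)$ is the set of infinite regular cardinals below $\lambda$. $\mathsf{CH}_\lambda$ means $2^\lambda=\lambda^+$. A $\square_\lambda$-sequence is $\langle C_\alpha:\alpha<\lambda^+\rangle$ such that for every limit $\alpha<\lambda^+$, $C_\alpha$ is a club in $\alpha$ of order type $\le\lambda$, and $\beta\in\operatorname{acc}(C_\alpha)$ implies $C_\beta=C_\alpha\cap\beta$; $\square_\lambda$ asserts one exists. For $\Gamma\subseteq\lambda^+$, $\diamondsuit\square^\Gamma_\lambda$ asserts the existence of a $\square_\lambda$-sequence $\langle C_\alpha:\alpha<\lambda^+\rangle$ and a sequence $\langle S_\alpha:\alpha<\lambda^+\rangle$ (with $S_\alpha\subseteq\alpha$) such that: (1) if $\alpha<\lambda^+$ is limit and $\beta\in\operatorname{acc}(C_\alpha)$ then $S_\beta=S_\alpha\cap\beta$; (2) for every club $D\subseteq\lambda^+$, every $A\subseteq\lambda^+$ and every nonzero limit $\theta\in\Gamma$ there is $\alpha<\lambda^+$ with $C_\alpha\subseteq D$, $S_\alpha=A\cap\alpha$,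 $\operatorname{cf}(\alpha)=\theta$, and $\sup(\operatorname{acc}(C_\alpha))=\alpha$. *)

(* Defs.v *)
(* Set-theoretic notions are developed internally to a
   well-ordered type T, which plays the role of the ordinal lambda^+.
   Ordinals below lambda^+ are the elements of T; subsets of ordinals
   are predicates T -> Prop. *)
From Stdlib Require Import Classical FunctionalExtensionality PropExtensionality.

Section SetTheory.
Set Implicit Arguments.
Context {T : Type}.
Variable lt : T -> T -> Prop.

Definition le (x y : T) : Prop := lt x y \/ x = y.

Definition is_well_order : Prop :=
  well_founded lt /\
  (forall x y z, lt x y -> lt y z -> lt x z) /\
  (forall x y, lt x y \/ x = y \/ lt y x).

Definition seg (a : T) : Type := {x : T | lt x a}.

Definition injective {A B : Type} (f : A -> B) : Prop :=
  forall x y, f x = f y -> x = y.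

Definition is_cardinal (a : T) : Prop :=
  forall b, lt b a -> ~ exists f : seg a -> seg b, injective f.

Definition is_succ_type (lam : T) : Prop :=
  is_cardinal lam /\
  (forall a, exists f : seg a -> seg lam, injective f) /\
  ~ (exists f : T -> seg lam, injective f).

Definition uncountable (a : T) : Prop :=
  ~ exists f : seg a -> nat, injective f.

Definition infinite (a : T) : Prop :=
  exists f : nat -> seg a, injective f.

Definition is_limit (a : T) : Prop :=
  (exists x, lt x a) /\ (forall x, lt x a -> exists y, lt x y /\ lt y a).

Definition is_sup (A : T -> Prop) (s : T) : Prop :=
  (forall x, A x -> le x s) /\
  (forall b, (forall x, A x -> le x b) -> le s b).

Definition cof_map (a t : T) : Prop :=
  exists f : seg t -> T,
    (forall x, lt (f x) a) /\
    (forall x y : seg t, lt (proj1_sig x) (proj1_sig y) -> lt (f x) (f y)) /\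
    (forall y, lt y a -> exists x, le y (f x)).

Definition cf_is (a t : T) : Prop :=
  cof_map a t /\ forall b, lt b t -> ~ cof_map a b.

Definition is_regular (a : T) : Prop := infinite a /\ cf_is a a.

Definition succ_of_regular (lam : T) : Prop :=
  exists mu, lt mu lam /\ is_regular mu /\
    forall nu, lt mu nu -> lt nu lam -> ~ is_cardinal nu.

Definition acc (A : T -> Prop) (a : T) : Prop :=
  A a /\ is_sup (fun x => A x /\ lt x a) a.

Definition club_in (C : T -> Prop) (a : T) : Prop :=
  (forall x, C x -> lt x a) /\
  (forall y, lt y a -> exists x, C x /\ le y x) /\
  (forall g, lt g a -> is_limit g -> is_sup (fun x => C x /\ lt x g) g -> C g).

Definition otp_le (C : T -> Prop) (lam : T) : Prop :=
  exists f : {x : T | C x} -> seg lam,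
    forall x y, lt (proj1_sig x) (proj1_sig y) ->
                lt (proj1_sig (f x)) (proj1_sig (f y)).

Definition club (D : T -> Prop) : Prop :=
  (forall y, exists x, D x /\ le y x) /\
  (forall g, is_limit g -> is_sup (fun x => D x /\ lt x g) g -> D g).

Definition square_seq (lam : T) (C : T -> T -> Prop) : Prop :=
  forall a, is_limit a ->
    club_in (C a) a /\ otp_le (C a) lam /\
    (forall b, acc (C a) b -> forall x, C b x <-> (C a x /\ lt x b)).

Definition square (lam : T) : Prop := exists C, square_seq lam C.

(* CH_lam : 2^lam = lam^+ (2^lam <= lam^+ ; the other inequality is ZFC) *)
Definition CH (lam : T) : Prop :=
  exists h : (seg lam -> Prop) -> T, injective h.

Definition diamond_square (lam : T) (Gamma : T -> Prop) : Prop :=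
  exists (C S : T -> T -> Prop),
    square_seq lam C /\
    (forall a x, S a x -> lt x a) /\
    (forall a, is_limit a -> forall b, acc (C a) b ->
        forall x, S b x <-> (S a x /\ lt x b)) /\
    (forall (D A : T -> Prop) (th : T), club D -> Gamma th -> is_limit th ->
       exists a,
         (forall x, C a x -> D x) /\
         (forall x, S a x <-> (A x /\ lt x a)) /\
         cf_is a th /\
         is_sup (acc (C a)) a).

End SetTheory.

(* Main.v *)
(** Let [e b] inject each [b] into [lam].  By CH a single ordinal [c] can code a [lam * lam]-matrix of
    subsets of an ordinal.  For regular [g < lam] other than [cf lam], consider the guess
    [R eta tau]: on a pair [b' < b] of [C_a] it proposes the [tau]-th set, in row [eta], coded by some
    [c < b] with [e b c <= eta], provided that the sets before [tau] were guessed correctly.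
    If every guess fails, the counterexamples, chosen by recursion on [tau], form a matrix that can
    be coded at once; at a point [a] of cofinality [g] with [otp C_a < lam] which is closed under
    everything, pigeonhole selects a row [eta], and the failures at [a], one for each [tau < lam], are
    pairwise distinct: too many for the fewer than [lam] available triples.
    To treat many [g] at the same time, the points of cofinality [g] are restricted to a stationary set
    where [otp C_a] is a constant [eps g].  The ordinals [eps g] cut each [C_a] into blocks, and within
    a block only the guess that belongs to its [g] is used, which preserves coherence. *)
Require Import Defs.
From Stdlib Require Import Classical ClassicalEpsilon.
From Stdlib Require Import FunctionalExtensionality PropExtensionality.
From Stdlib Require Import PeanoNat Cantor Inverse_Image.

(** * Choice, well-founded recursion and comparison of cardinalities *)

Lemma choice {A B : Type} (R : A -> B -> Prop) :
  (forall x, exists y, R x y) -> exists f : A -> B, forall x, R x (f x).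
Proof.
  intro H. exists (fun x => proj1_sig (constructive_indefinite_description _ (H x))).
  intro x. apply proj2_sig.
Qed.

(** [step] receives a total function, equal to the junk value [x0] away from the predecessors of
    [a]; locality of [step] makes the junk invisible. *)
Lemma wf_rec {A X : Type} (R : A -> A -> Prop) (x0 : X) (step : A -> (A -> X) -> X) :
  well_founded R ->
  (forall a p q, (forall s, R s a -> p s = q s) -> step a p = step a q) ->
  exists p, forall a, p a = step a p.
Proof.
  intros Hwf Hext.
  exists (Fix Hwf (fun _ => X) (fun a rec => step a (fun s =>
    match excluded_middle_informative (R s a) with
    | left h => rec s h
    | right _ => x0
    end))).
  intro a. rewrite Fix_eq.
  - apply Hext. intros s Hs.
    destruct (excluded_middle_informative (R s a)); tauto.
  - intros x f g Hfg. apply Hext. intros s Hs.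
    destruct (excluded_middle_informative (R s x)); auto.
Qed.

Lemma wf_min {A : Type} (R : A -> A -> Prop) (P : A -> Prop) :
  well_founded R -> (exists x, P x) ->
  exists x, P x /\ forall y, P y -> ~ R y x.
Proof.
  intros Hwf [x Hx]. induction (Hwf x) as [x _ IH].
  destruct (classic (exists y, P y /\ R y x)) as [[y [Hy Hyx]]|H].
  - eauto.
  - exists x; split; auto. intros y Hy Hyx. apply H; eauto.
Qed.

(** Cardinal comparison by total functions that matter only on [P], which keeps subset types out of
    the arithmetic. *)
Definition emb {A B : Type} (P : A -> Prop) (Q : B -> Prop) : Prop :=
  exists f : A -> B, (forall x, P x -> Q (f x)) /\
    forall x y, P x -> P y -> f x = f y -> x = y.

Definition sq {A : Type} (P : A -> Prop) : A * A -> Prop :=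
  fun p => P (fst p) /\ P (snd p).

Lemma emb_trans {A B D : Type} (P : A -> Prop) (Q : B -> Prop) (U : D -> Prop) :
  emb P Q -> emb Q U -> emb P U.
Proof.
  intros [f [Hf If]] [g [Hg Ig]]. exists (fun x => g (f x)). split; auto.
Qed.

Lemma emb_incl {A : Type} (P Q : A -> Prop) : (forall x, P x -> Q x) -> emb P Q.
Proof. intros H. exists (fun x => x). split; auto. Qed.

Lemma emb_sq {A B : Type} (P : A -> Prop) (Q : B -> Prop) : emb P Q -> emb (sq P) (sq Q).
Proof.
  intros [f [Hf If]]. exists (fun p => (f (fst p), f (snd p))). split.
  - intros [x y] [Hx Hy]. split; simpl in *; auto.
  - intros [x y] [x' y'] [Hx Hy] [Hx' Hy'] E. simpl in *. injection E as E1 E2.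
    f_equal; auto.
Qed.

Lemma emb_nat_sq : emb (sq (fun _ : nat => True)) (fun _ : nat => True).
Proof.
  exists to_nat. split; auto. intros p q _ _ E.
  rewrite <- (cancel_of_to p), <- (cancel_of_to q). now rewrite E.
Qed.

(** [a0] is the value outside the image. Choosing it in [P] keeps all values in [P], as cofinal maps
    require. *)
Lemma emb_inverse {A B : Type} (P : A -> Prop) (Q : B -> Prop) (a0 : A) :
  emb P Q -> exists g : B -> A, (P a0 -> forall y, P (g y)) /\ forall x, P x -> exists y, Q y /\ g y = x.
Proof.
  intros [f [Hf If]].
  destruct (choice (fun y x => ((exists x', P x' /\ f x' = y) -> P x /\ f x = y) /\ (P a0 -> P x))) as [g Hg].
  { intro y. destruct (classic (exists x, P x /\ f x = y)) as [[x Hx]|H].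
    - exists x. tauto.
    - exists a0. tauto. }
  exists g. split.
  - intros H0 y. now apply Hg.
  - intros x Hx. exists (f x). split; auto.
    destruct (Hg (f x)) as [H _]. destruct H as [H1 H2]; eauto.
Qed.

(** * Order reasoning, least elements and ranks *)

Section WellOrder.
Context {T : Type} {lt : T -> T -> Prop} (lam : T) (Hwo : is_well_order lt).

Local Notation "x < y" := (lt x y).
Local Notation "x <= y" := (le lt x y).
Local Notation below a := (fun x => lt x a).

Lemma lt_wf : well_founded lt. Proof. apply Hwo. Qed.

Lemma lt_trans x y z : x < y -> y < z -> x < z. Proof. apply Hwo. Qed.

Lemma lt_irrefl x : ~ x < x.
Proof. induction (lt_wf x) as [x _ IH]. intro H. exact (IH x H H). Qed.

Lemma lt_total x y : x < y \/ x = y \/ y < x. Proof. apply Hwo. Qed.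

Lemma le_refl x : x <= x. Proof. now right. Qed.

Lemma not_lt x y : ~ x < y -> y <= x.
Proof. intro H. destruct (lt_total x y) as [|[->|]]; [tauto|apply le_refl|now left]. Qed.

Lemma le_lt_trans x y z : x <= y -> y < z -> x < z.
Proof. intros [H| ->]; auto. intro; eapply lt_trans; eauto. Qed.

Lemma lt_le_trans x y z : x < y -> y <= z -> x < z.
Proof. intros H [H'| <-]; auto. eapply lt_trans; eauto. Qed.

Lemma le_trans x y z : x <= y -> y <= z -> x <= z.
Proof. intros [H| ->]; auto. intro; left; eapply lt_le_trans; eauto. Qed.

Lemma not_le x y : ~ x <= y -> y < x.
Proof. intro H. destruct (lt_total x y) as [|[->|]]; auto; destruct H; [now left|apply le_refl]. Qed.

Lemma le_antisym x y : x <= y -> y <= x -> x = y.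
Proof. intros [H|] [H'|]; auto. destruct (lt_irrefl x). eapply lt_trans; eauto. Qed.

Ltac ord_sat :=
  repeat match goal with
  | H : lt ?x ?x |- _ => exfalso; exact (lt_irrefl x H)
  | H : ~ lt ?x ?y |- _ => apply not_lt in H
  | H : ~ le lt ?x ?y |- _ => apply not_le in H
  | H1 : lt ?x ?y, H2 : lt ?y ?z |- _ =>
      lazymatch goal with _ : lt x z |- _ => fail | _ => pose proof (lt_trans x y z H1 H2) end
  | H1 : le lt ?x ?y, H2 : lt ?y ?z |- _ =>
      lazymatch goal with _ : lt x z |- _ => fail | _ => pose proof (le_lt_trans x y z H1 H2) end
  | H1 : lt ?x ?y, H2 : le lt ?y ?z |- _ =>
      lazymatch goal with _ : lt x z |- _ => fail | _ => pose proof (lt_le_trans x y z H1 H2) end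
  | H1 : le lt ?x ?y, H2 : le lt ?y ?z |- _ =>
      lazymatch goal with _ : le lt x z |- _ => fail | _ => pose proof (le_trans x y z H1 H2) end
  end.

Ltac ord :=
  solve [ intros; subst;
  match goal with
  | |- lt _ _ => apply NNPP; intro; ord_sat
  | |- le lt _ _ => apply NNPP; intro; ord_sat
  | |- _ = _ => apply le_antisym; apply NNPP; intro; ord_sat
  | |- _ => exfalso; ord_sat
  end ].

Definition mu (P : T -> Prop) : T :=
  epsilon (inhabits lam) (fun z => P z /\ forall y, P y -> z <= y).

Lemma mu_spec (P : T -> Prop) : (exists z, P z) -> P (mu P) /\ forall y, P y -> mu P <= y.
Proof.
  intro H. unfold mu. apply epsilon_spec.
  destruct (wf_min lt P lt_wf H) as [x [Hx Hm]]. exists x. split; auto.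
  intros y Hy. apply not_lt. auto.
Qed.

Definition is_rank {A : Type} (R : A -> A -> Prop) (rk : A -> T) : Prop :=
  forall a, rk a = mu (fun z => forall s, R s a -> rk s < z).

Lemma rank_exists {A : Type} (R : A -> A -> Prop) : well_founded R -> exists rk, is_rank R rk.
Proof.
  intro Hwf.
  apply (wf_rec R lam (fun a rk => mu (fun z => forall s, R s a -> rk s < z)) Hwf).
  intros a p q H. f_equal. extensionality z. apply propositional_extensionality.
  split; intros K s Hs; [rewrite <- H|rewrite H]; auto.
Qed.

(** [T] need not contain a bound for the ranks of the predecessors, so the bound [z] is supplied; it
    makes [mu] meaningful. *)
Lemma rank_spec {A : Type} (R : A -> A -> Prop) rk a z :
  is_rank R rk -> (forall s, R s a -> rk s < z) ->
  rk a <= z /\ forall s, R s a -> rk s < rk a.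
Proof.
  intros Hrk Hz. pose proof (mu_spec (fun z => forall s, R s a -> rk s < z)) as H.
  rewrite <- (Hrk a) in H. destruct H as [H1 H2]; [now exists z|]. split; auto.
Qed.

(** At an [R]-minimal [s] of rank at least [z], all predecessors have rank below [z], so the rank of
    [s] is exactly [z]. *)
Lemma rank_onto {A : Type} (R : A -> A -> Prop) rk a z :
  well_founded R -> (forall x y z, R x y -> R y z -> R x z) ->
  is_rank R rk -> (forall s, R s a -> rk s < rk a) -> z < rk a ->
  exists s, R s a /\ rk s = z.
Proof.
  intros Hwf Htr Hrk Ha Hz.
  assert (exists s, R s a /\ z <= rk s) as Hex.
  { apply NNPP. intro Hn. destruct (rank_spec R rk a z Hrk).
    - intros s Hs. apply not_le. intro. apply Hn. eauto.
    - ord. }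
  destruct (wf_min R (fun s => R s a /\ z <= rk s) Hwf Hex) as [s [[Hs1 Hs2] Hs3]].
  exists s. split; auto. apply le_antisym; auto.
  apply (rank_spec R rk s z Hrk). intros q Hq. apply not_le. intro.
  apply (Hs3 q); auto. split; auto. eapply Htr; eauto.
Qed.

(** * The given cardinality notions in terms of embeddings *)

Lemma seg_emb_iff a b : (exists f : seg lt a -> seg lt b, injective f) <-> emb (below a) (below b).
Proof.
  split.
  - intros [f Hf].
    exists (fun x => match excluded_middle_informative (x < a) with
                     | left h => proj1_sig (f (exist _ x h))
                     | right _ => x end).
    split.
    + intros x Hx. destruct (excluded_middle_informative (x < a)); [|tauto].
      exact (proj2_sig (f (exist _ x l))).
    + intros x y Hx Hy.
      destruct (excluded_middle_informative (x < a)) as [h|]; [|tauto].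
      destruct (excluded_middle_informative (y < a)) as [h'|]; [|tauto].
      intro E. assert (f (exist _ x h) = f (exist _ y h')) as E'.
      { destruct (f (exist _ x h)), (f (exist _ y h')). simpl in E. subst. f_equal. apply proof_irrelevance. }
      apply Hf in E'. now injection E'.
  - intros [f [Hf If]].
    exists (fun x : seg lt a => exist (fun y => y < b) (f (proj1_sig x)) (Hf _ (proj2_sig x))).
    intros [x hx] [y hy] E. simpl in E. injection E as E. apply If in E; auto. subst.
    f_equal. apply proof_irrelevance.
Qed.

Lemma infinite_iff a : infinite lt a <-> emb (fun _ : nat => True) (below a).
Proof.
  split.
  - intros [f Hf]. exists (fun n => proj1_sig (f n)). split.
    + intros n _. exact (proj2_sig (f n)).
    + intros n m _ _ E. apply Hf. destruct (f n), (f m). simpl in E. subst.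
      f_equal. apply proof_irrelevance.
  - intros [f [Hf If]]. exists (fun n => exist (fun x => x < a) (f n) (Hf n I)).
    intros n m E. injection E as E. auto.
Qed.

Lemma uncountable_iff a : uncountable lt a <-> ~ emb (below a) (fun _ : nat => True).
Proof.
  unfold uncountable. split; intros H K; apply H; clear H.
  - destruct K as [f [Hf If]]. exists (fun x => f (proj1_sig x)).
    intros [x hx] [y hy] E. simpl in E. apply If in E; auto. subst.
    f_equal. apply proof_irrelevance.
  - destruct K as [f Hf].
    exists (fun x => match excluded_middle_informative (x < a) with
                     | left h => f (exist _ x h)
                     | right _ => 0 end).
    split; auto.
    intros x y Hx Hy.
    destruct (excluded_middle_informative (x < a)) as [h|]; [|tauto].
    destruct (excluded_middle_informative (y < a)) as [h'|]; [|tauto].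
    intro E. apply Hf in E. now injection E.
Qed.

(** The second coordinate tells the extra point [M] apart: it is [v] there and [u] elsewhere. *)
Lemma emb_le_sq {B : Type} (Q : B -> Prop) M u v :
  emb (below M) Q -> Q u -> Q v -> u <> v -> emb (fun x => x <= M) (sq Q).
Proof.
  intros [f [Hf If]] Hu Hv Huv.
  exists (fun x => if excluded_middle_informative (x < M) then (f x, u) else (u, v)). split.
  - intros x Hx. destruct (excluded_middle_informative (x < M)); split; simpl; auto.
  - intros x y Hx Hy.
    destruct (excluded_middle_informative (x < M)), (excluded_middle_informative (y < M));
    intro E; try (injection E; intros; congruence).
    + injection E; auto.
    + ord.
Qed.

(** * The Gödel order of pairs and squares of infinite cardinals *)

Definition pmax (p : T * T) : T :=
  if excluded_middle_informative (fst p < snd p) then snd p else fst p.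

Definition godel (p q : T * T) : Prop :=
  pmax p < pmax q \/ pmax p = pmax q /\ (fst p < fst q \/ fst p = fst q /\ snd p < snd q).

Lemma godel_trans p q r : godel p q -> godel q r -> godel p r.
Proof.
  unfold godel. intros [H|[-> [H|[-> H]]]] [H'|[E [H'|[E' H']]]]; try rewrite <- E; try rewrite <- E';
  eauto 8 using lt_trans.
Qed.

Lemma godel_total p q : godel p q \/ p = q \/ godel q p.
Proof.
  unfold godel.
  destruct (lt_total (pmax p) (pmax q)) as [|[|]]; auto.
  destruct (lt_total (fst p) (fst q)) as [|[|]]; auto 8 using eq_sym.
  destruct (lt_total (snd p) (snd q)) as [|[|]]; auto 8 using eq_sym.
  right; left. destruct p, q; simpl in *; congruence.
Qed.

Lemma godel_wf : well_founded godel.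
Proof.
  assert (forall m x y p, pmax p = m -> fst p = x -> snd p = y -> Acc godel p) as H.
  { intro m. induction (lt_wf m) as [m _ IHm].
    intro x. induction (lt_wf x) as [x _ IHx].
    intro y. induction (lt_wf y) as [y _ IHy].
    intros p Hm Hx Hy. constructor. intros q [H|[H [H'|[H' H'']]]].
    - rewrite Hm in H. eapply IHm; eauto.
    - rewrite Hx in H'. eapply IHx; eauto. congruence.
    - rewrite Hy in H''. eapply IHy; eauto; congruence. }
  intro p. eapply H; reflexivity.
Qed.

Lemma pmax_spec p : fst p <= pmax p /\ snd p <= pmax p /\ (pmax p = fst p \/ pmax p = snd p).
Proof.
  unfold pmax. destruct (excluded_middle_informative (fst p < snd p)); repeat split; auto; ord.
Qed.

Lemma godel_pmax p q : godel p q -> pmax p <= pmax q.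
Proof. intros [H|[H _]]; [now left|now right]. Qed.

(** [w] is the supremum of the first omega elements [s n]; uncountability of [T] guarantees that
    they are bounded. *)
Lemma enum_omega : ~ emb (fun _ : T => True) (fun _ : nat => True) ->
  exists w, emb (fun _ : nat => True) (below w) /\ emb (below w) (fun _ : nat => True).
Proof.
  intro Hnc.
  pose (s := fix s n := match n with O => mu (fun _ => True) | S n => mu (fun y => s n < y) end).
  assert (Hdown : forall n z, z <= s n -> exists k, z = s k).
  { induction n; intros z Hz.
    - exists 0. simpl in *. apply le_antisym; auto. apply (mu_spec (fun _ => True)); eauto.
    - destruct (classic (z <= s n)) as [|Hn]; auto. apply not_le in Hn.
      exists (S n). apply le_antisym; auto. simpl. apply mu_spec; eauto. }
  assert (Hb : exists w, forall n, s n < w).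
  { apply NNPP. intro Hn. apply Hnc.
    destruct (choice (fun z k => z = s k)) as [f Hf].
    { intro z. apply NNPP. intro Hz. apply Hn. exists z. intro n.
      apply not_le. intro. apply Hz. eauto. }
    exists f. split; auto. intros x y _ _ E. rewrite (Hf x), (Hf y). congruence. }
  destruct (mu_spec _ Hb) as [Hw1 Hw2]. set (w := mu (fun w => forall n, s n < w)) in *.
  assert (Hs : forall n, s n < s (S n)).
  { intro n. simpl. apply (mu_spec (fun y => s n < y)). eauto. }
  exists w. split.
  - exists s. split; auto. intros n m _ _.
    assert (Hlt : forall m n, Nat.lt n m -> s n < s m).
    { clear n m. intros m n H. induction H; eauto using lt_trans. }
    intro E. destruct (Nat.lt_trichotomy n m) as [H|[H|H]]; auto;
    apply Hlt in H; rewrite E in H; ord.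
  - destruct (choice (fun z k => z < w -> z = s k)) as [f Hf].
    { intro z. destruct (classic (z < w)) as [Hz|Hz]; [|exists 0; tauto].
      assert (exists n, z <= s n) as [n Hn].
      { apply NNPP. intro Hn. assert (w <= z); [|ord]. apply Hw2. intro n. apply not_le. eauto. }
      destruct (Hdown n z Hn) as [k Hk]. eauto. }
    exists f. split; auto. intros x y Hx Hy E. rewrite (Hf x), (Hf y); congruence.
Qed.

(** Induction on [m]. If the claim fails at an uncountable [m], then [m] embeds into no square of a
    smaller ordinal, so all pairs from [m] have Gödel rank below [m], and the rank itself is an
    embedding. *)
Lemma hessenberg m : infinite lt m -> emb (sq (below m)) (below m).
Proof.
  rewrite infinite_iff. induction (lt_wf m) as [m _ IH]. intro Hinf.
  destruct (classic (emb (below m) (fun _ : nat => True))) as [Hc|Hc].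
  { eapply emb_trans; [exact (emb_sq _ _ Hc)|]. eapply emb_trans; [exact emb_nat_sq|exact Hinf]. }
  apply NNPP. intro Hno.
  destruct enum_omega as [w [Hw1 Hw2]].
  { intro K. apply Hc. eapply emb_trans; [|exact K]. apply emb_incl; auto. }
  assert (Hwm : w < m).
  { apply not_le. intro K. apply Hc. eapply emb_trans; [|exact Hw2].
    apply emb_incl. intros; ord. }
  (* [N] bounds both [M] and omega, so the induction hypothesis applies to [N]; then [m] embeds into
     [N], and so does its square. *)
  assert (Hsmall : forall M, M < m -> ~ emb (below m) (sq (fun x => x <= M))).
  { intros M HM.
    assert (exists N, w <= N /\ M <= N /\ N < m) as [N [H1 [H2 H3]]].
    { destruct (classic (w <= M)) as [|K]; [exists M|exists w];
      repeat split; auto using le_refl. apply not_le in K; now left. }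
    assert (HN : emb (fun _ : nat => True) (below N)).
    { eapply emb_trans; [exact Hw1|]. apply emb_incl; intros; ord. }
    intro K. apply Hno.
    assert (emb (sq (below N)) (below N)) as HNN by auto.
    assert (emb (fun x => x <= M) (below N)) as HMN.
    { eapply emb_trans; [|exact HNN].
      apply emb_trans with (fun x => x <= N); [apply emb_incl; intros; ord|].
      destruct HN as [f [Hf If]].
      apply (emb_le_sq (below N) N (f 0) (f 1)); auto.
      - apply emb_incl; auto.
      - intro E. apply If in E; auto. discriminate. }
    assert (emb (below m) (below N)) as HmN.
    { eapply emb_trans; [exact K|]. eapply emb_trans; [exact (emb_sq _ _ HMN)|exact HNN]. }
    eapply emb_trans; [exact (emb_sq _ _ HmN)|]. eapply emb_trans; [exact HNN|].
    apply emb_incl. intros; ord. }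
  destruct (rank_exists godel godel_wf) as [rk Hrk].
  assert (Hlt : forall p, sq (below m) p -> rk p < m /\ forall q, godel q p -> rk q < rk p).
  { intro p. induction (godel_wf p) as [p _ IHp]. intros [Hp1 Hp2].
    set (M := pmax p).
    assert (HM : M < m) by (destruct (pmax_spec p) as [_ [_ [E|E]]]; unfold M; rewrite E; auto).
    assert (Hq : forall q, godel q p -> fst q <= M /\ snd q <= M).
    { intros q K. apply godel_pmax in K. fold M in K. destruct (pmax_spec q) as [? [? _]]. split; ord. }
    destruct (rank_spec godel rk p m Hrk) as [H1 H2].
    { intros q K. apply IHp; auto. destruct (Hq q K). split; ord. }
    split; auto. apply NNPP. intro Hn. apply not_lt in Hn.
    apply (Hsmall M HM).
    destruct (choice (fun z q => z < m -> godel q p /\ rk q = z)) as [f Hf].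
    { intro z. destruct (classic (z < m)) as [Hz|]; [|exists p; tauto].
      destruct (rank_onto godel rk p z) as [q ?]; eauto using godel_wf, godel_trans.
      ord. }
    exists f. split.
    - intros z Hz. apply Hq. now apply Hf.
    - intros x y Hx Hy E. destruct (Hf x Hx) as [_ <-], (Hf y Hy) as [_ <-]. congruence. }
  apply Hno. exists rk. split; [intros; now apply Hlt|].
  intros p q Hp Hq E. destruct (godel_total p q) as [K|[K|K]]; auto.
  - apply Hlt in K; auto. rewrite E in K; ord.
  - apply Hlt in K; auto. rewrite E in K; ord.
Qed.

Lemma emb_le m : infinite lt m -> emb (fun x => x <= m) (below m).
Proof.
  intro Hm. eapply emb_trans; [|exact (hessenberg m Hm)].
  apply infinite_iff in Hm as [f [Hf If]].
  apply (emb_le_sq (below m) m (f 0) (f 1)); auto.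
  - apply emb_incl; auto.
  - intro E. apply If in E; auto. discriminate.
Qed.

(** * Cofinality and regular cardinals *)

(** [f] need not be monotone, so [b] is only an upper bound for the cofinality of [a]. *)
Definition ub (b a : T) : Prop :=
  exists f : T -> T, (forall x, x < b -> f x < a) /\ forall y, y < a -> exists x, x < b /\ y <= f x.

Definition reg (g : T) : Prop := forall b, b < g -> ~ ub b g.

Definition cofinal_in (a t : T) (f : T -> T) : Prop :=
  (forall x, x < t -> f x < a) /\
  (forall x y, x < y -> y < t -> f x < f y) /\
  (forall y, y < a -> exists x, x < t /\ y <= f x).

Lemma cof_map_iff a t : cof_map lt a t <-> exists f, cofinal_in a t f.
Proof.
  split.
  - intros [f [H1 [H2 H3]]].
    set (F := fun x => match excluded_middle_informative (x < t) with
                       | left h => f (exist _ x h)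
                       | right _ => x end).
    assert (HF : forall x (h : x < t), F x = f (exist _ x h)).
    { intros x h. unfold F. destruct (excluded_middle_informative (x < t)); [|tauto].
      f_equal. f_equal. apply proof_irrelevance. }
    exists F. split; [|split].
    + intros x h. rewrite (HF x h). auto.
    + intros x y Hxy h. rewrite (HF y h), (HF x (lt_trans _ _ _ Hxy h)). auto.
    + intros y Hy. destruct (H3 y Hy) as [[x h] Hx]. exists x. rewrite (HF x h). auto.
  - intros [f [H1 [H2 H3]]]. exists (fun x => f (proj1_sig x)). split; [|split].
    + intros [x h]. auto.
    + intros [x h] [y h']. simpl. auto.
    + intros y Hy. destruct (H3 y Hy) as [x [h Hx]]. now exists (exist _ x h).
Qed.

Lemma cof_map_ub a t : cof_map lt a t -> ub t a.
Proof. rewrite cof_map_iff. intros [f [H1 [_ H3]]]. now exists f. Qed.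

Lemma not_ub b a f : ~ ub b a -> (forall x, x < b -> f x < a) ->
  exists y, y < a /\ forall x, x < b -> f x < y.
Proof.
  intros Hn Hf. apply NNPP. intro K. apply Hn. exists f. split; auto.
  intros y Hy. apply NNPP. intro K'. apply K. exists y. split; auto.
  intros x Hx. apply not_le. intro. apply K'. eauto.
Qed.

(** For the least [b] with an unbounded map [f] into [g], recursion replaces [f] by a strictly
    increasing [h] above it; minimality of [b] keeps each [h i] below [g]. This contradicts [cf_is],
    which speaks of increasing maps. *)
Lemma reg_of_regular g : is_regular lt g -> reg g.
Proof.
  intros [_ [_ Hcf]] b0 Hb0 Hub0.
  destruct (wf_min lt (fun b => b < g /\ ub b g) lt_wf) as [b [[Hb [f [Hf1 Hf2]]] Hmin]]; eauto.
  apply (Hcf b Hb). apply cof_map_iff.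
  destruct (wf_rec lt lam (fun i p => mu (fun z => f i <= z /\ forall j, j < i -> p j < z)) lt_wf) as [h Hh].
  { intros i p q E. f_equal. extensionality z. apply propositional_extensionality.
    split; intros [H1 H2]; split; auto; intros j Hj; [rewrite <- E|rewrite E]; auto. }
  assert (Hs : forall i, i < b -> h i < g /\ f i <= h i /\ forall j, j < i -> h j < h i).
  { intro i. induction (lt_wf i) as [i _ IH]. intro Hi.
    destruct (not_ub i g h) as [y [Hy1 Hy2]].
    - intro K. apply (Hmin i); auto. split; auto. ord.
    - intros x Hx. apply IH; auto. ord.
    - assert (exists z, z < g /\ f i <= z /\ y <= z) as [z [Hz1 [Hz2 Hz3]]].
      { destruct (classic (y <= f i)) as [|K]; [exists (f i)|exists y]; repeat split; auto using le_refl.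
        apply not_le in K. now left. }
      destruct (mu_spec (fun z => f i <= z /\ forall j, j < i -> h j < z)) as [M1 M2].
      { exists z. split; auto. intros j Hj. apply Hy2 in Hj. ord. }
      rewrite <- Hh in M1, M2. split; [|exact M1].
      assert (h i <= z); [apply M2|ord]. split; auto. intros j Hj. apply Hy2 in Hj. ord. }
  exists h. split; [|split].
  - intros; now apply Hs.
  - intros x y Hxy Hy. now apply (Hs y).
  - intros y Hy. destruct (Hf2 y Hy) as [x [Hx1 Hx2]]. exists x. split; auto.
    destruct (Hs x Hx1) as [_ [? _]]. ord.
Qed.

Lemma reg_not_emb g b : reg g -> b < g -> ~ emb (below g) (below b).
Proof.
  intros Hg Hb He. apply (Hg b Hb).
  destruct (emb_inverse _ _ b He) as [k [Hk1 Hk2]]. exists k. split; auto.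
  intros y Hy. destruct (Hk2 y Hy) as [x [Hx1 Hx2]]. exists x. split; auto. now right.
Qed.

Lemma infinite_mono a b : a <= b -> infinite lt a -> infinite lt b.
Proof.
  rewrite !infinite_iff. intros H K. eapply emb_trans; [exact K|]. apply emb_incl. intros; ord.
Qed.

(** A cofinal map from some [b] below [nu] would cover [nu] by at most [th] sets of size at most
    [th], and so embed [nu] into the square of [th]. *)
Lemma successor_cardinal_regular th nu :
  infinite lt th -> th < nu -> is_cardinal lt nu ->
  (forall x, x < nu -> emb (below x) (below th)) -> is_regular lt nu.
Proof.
  intros Hth Hnu Hcard Hsm.
  assert (Hle : forall x, x < nu -> emb (fun y => y <= x) (below th)).
  { intros x Hx. eapply emb_trans; [|exact (hessenberg th Hth)].
    apply infinite_iff in Hth as [f [Hf If]].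
    apply (emb_le_sq (below th) x (f 0) (f 1)); auto.
    intro E. apply If in E; auto. discriminate. }
  split; [apply (infinite_mono th nu); auto; ord|]. split.
  - apply cof_map_iff. exists (fun x => x). split; [|split]; auto.
    intros y Hy. exists y. split; auto. apply le_refl.
  - intros b Hb Hc. apply cof_map_ub in Hc as [f [Hf1 Hf2]].
    apply (Hcard th Hnu). apply seg_emb_iff.
    apply emb_trans with (sq (below th)); [|now apply hessenberg].
    destruct (Hsm b Hb) as [i [Hi Ii]].
    destruct (choice (fun z x => z < nu -> x < b /\ z <= f x)) as [p Hp].
    { intro z. destruct (classic (z < nu)) as [Hz|Hz]; [|exists z; tauto].
      destruct (Hf2 z Hz) as [x Hx]. eauto. }
    destruct (choice (fun x (j : T -> T) => x < b -> (forall y, y <= f x -> j y < th) /\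
      forall y y', y <= f x -> y' <= f x -> j y = j y' -> y = y')) as [j Hj].
    { intro x. destruct (classic (x < b)) as [Hx|Hx]; [|exists (fun y => y); tauto].
      destruct (Hle (f x) (Hf1 x Hx)) as [j Hj]. eauto. }
    exists (fun z => (i (p z), j (p z) z)). split.
    + intros z Hz. destruct (Hp z Hz) as [H1 H2]. split; simpl; auto. now apply Hj.
    + intros z z' Hz Hz' E. injection E as E1 E2.
      destruct (Hp z Hz) as [H1 H2], (Hp z' Hz') as [H1' H2'].
      apply Ii in E1; auto. rewrite E1 in *. destruct (Hj _ H1) as [_ H3]. auto.
Qed.

(** * The cardinal [lam] and its successor *)

Context (Hsucc : is_succ_type lt lam) (Hunc : uncountable lt lam).

Lemma omega_below : exists w, w < lam /\ infinite lt w.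
Proof.
  apply uncountable_iff in Hunc.
  destruct enum_omega as [w [H1 H2]].
  - intro K. apply Hunc. eapply emb_trans; [|exact K]. apply emb_incl; auto.
  - exists w. split; [|now apply infinite_iff].
    apply not_le. intro K. apply Hunc. eapply emb_trans; [|exact H2].
    apply emb_incl. intros; ord.
Qed.

Lemma lam_infinite : infinite lt lam.
Proof. destruct omega_below as [w [H1 H2]]. apply (infinite_mono w lam); auto. now left. Qed.

Lemma lam_not_emb m : m < lam -> ~ emb (below lam) (below m).
Proof.
  intros Hm K. destruct Hsucc as [Hc _]. apply (Hc m Hm). now apply seg_emb_iff.
Qed.

Lemma emb_below_lam a : emb (below a) (below lam).
Proof. apply seg_emb_iff. apply Hsucc. Qed.

Lemma univ_not_emb : ~ emb (fun _ : T => True) (below lam).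
Proof.
  intros [f [Hf If]]. destruct Hsucc as [_ [_ Hn]]. apply Hn.
  exists (fun x => exist _ (f x) (Hf x I)). intros x y E. injection E. auto.
Qed.

Lemma no_max x : exists y, x < y.
Proof.
  apply NNPP. intro K. apply univ_not_emb.
  apply emb_trans with (sq (below lam)); [|apply hessenberg, lam_infinite].
  apply emb_trans with (fun y => y <= x).
  - apply emb_incl. intros y _. apply not_lt. eauto.
  - pose proof lam_infinite as Hl. apply infinite_iff in Hl as [f [Hf If]].
    apply (emb_le_sq (below lam) x (f 0) (f 1)); auto using emb_below_lam.
    intro E. apply If in E; auto. discriminate.
Qed.

(** Regularity of the successor of [lam]: an unbounded family would make [T] a union of [lam] many
    sets of size at most [lam]. *)
Lemma bounded {A : Type} (P : A -> Prop) (f : A -> T) :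
  emb P (below lam) -> exists z, forall a, P a -> f a < z.
Proof.
  intros [i [Hi Ii]].
  assert (exists z, forall a, P a -> f a <= z) as [z Hz].
  { apply NNPP. intro K. apply univ_not_emb.
    apply emb_trans with (sq (below lam)); [|apply hessenberg, lam_infinite].
    destruct (choice (fun z a => P a /\ z < f a)) as [p Hp].
    { intro z. apply NNPP. intro K'. apply K. exists z. intros a Ha. apply not_lt. eauto. }
    destruct (choice (fun b (e : T -> T) => (forall x, x < b -> e x < lam) /\
      forall x y, x < b -> y < b -> e x = e y -> x = y) emb_below_lam) as [e He].
    exists (fun z => (i (p z), e (f (p z)) z)). split.
    - intros z _. destruct (Hp z). split; simpl; auto. now apply He.
    - intros z z' _ _ E. injection E as E1 E2.
      destruct (Hp z) as [H1 H2], (Hp z') as [H1' H2'].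
      apply Ii in E1; auto. rewrite E1 in *. now apply He in E2. }
  destruct (no_max z) as [y Hy]. exists y. intros a Ha. apply Hz in Ha. ord.
Qed.

(** [nu] is the cardinal successor of [th], and lies below [lam] because [lam] is not the successor
    of a regular cardinal; [b] is the ordinal successor of [th]. *)
Lemma next_regular th : ~ succ_of_regular lt lam -> th < lam -> is_regular lt th ->
  exists nu, th < nu /\ nu < lam /\ is_regular lt nu /\
    exists b, b < nu /\ infinite lt b /\ forall g, is_regular lt g -> g < nu -> g < b.
Proof.
  intros Hnsr Hth Hreg.
  destruct (wf_min lt (fun nu => th < nu /\ nu < lam /\ is_cardinal lt nu) lt_wf)
    as [nu [[H1 [H2 H3]] Hmin]].
  { apply NNPP. intro K. apply Hnsr. exists th. split; [auto|split; [auto|]].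
    intros nu Hnu1 Hnu2 Hnu3. apply K. eauto. }
  assert (Hsm : forall x, x < nu -> emb (below x) (below th)).
  { intros x Hx.
    destruct (wf_min lt (fun y => emb (below x) (below y)) lt_wf) as [y [Hy1 Hy2]].
    { exists x. now apply emb_incl. }
    apply emb_trans with (below y); auto. apply emb_incl. intros z Hz.
    assert (y <= x) by (apply not_lt, Hy2, emb_incl; auto).
    apply NNPP. intro Hn. apply (Hmin y).
    - split; [ord|]. split; [ord|]. intros b Hb Hc. apply seg_emb_iff in Hc.
      apply (Hy2 b); auto. eapply emb_trans; eauto.
    - ord. }
  assert (Hinf : infinite lt th) by apply Hreg.
  exists nu. split; [auto|]. split; [auto|].
  split; [apply (successor_cardinal_regular th nu); auto|].
  destruct (no_max th) as [y0 Hy0].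
  destruct (mu_spec (fun y => th < y)) as [M1 M2]; [now exists y0|].
  exists (mu (fun y => th < y)). repeat split.
  - destruct (M2 nu H1) as [|E]; auto. exfalso. apply (H3 th H1). apply seg_emb_iff.
    eapply emb_trans; [|apply (emb_le th Hinf)]. apply emb_incl. intros x Hx.
    apply not_lt. intro K. apply M2 in K. rewrite E in K. ord.
  - apply (infinite_mono th); auto. now left.
  - intros g Hg1 Hg2. apply reg_of_regular in Hg1.
    assert (g <= th); [|ord]. apply not_lt. intro K. apply (reg_not_emb g th Hg1 K); auto.
Qed.

(** * Cofinalities different from that of [lam] *)

(* Says that [cf a] differs from [cf lam]. *)
Definition pigeon (a : T) : Prop :=
  forall k : T -> T, (forall x, x < a -> k x < lam) ->
  exists eta, eta < lam /\ forall y, y < a -> exists x, y <= x /\ x < a /\ k x <= eta.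

(** If both failed, [f1] would be unbounded in [lam] and [f2] would tend to [lam]. With [beta eta] a
    point from which on [f2] exceeds [eta], the map [beta] after [f1] is unbounded from [g1] into
    the regular [g2]. *)
Lemma pigeon_or g1 g2 : (exists x, x < g1) -> g1 < g2 -> reg g2 -> pigeon g1 \/ pigeon g2.
Proof.
  intros [x0 Hx0] Hlt Hreg. apply NNPP. intro K. apply not_or_and in K as [K1 K2].
  apply not_all_ex_not in K1 as [f1 K1]. apply imply_to_and in K1 as [Hf1 K1].
  apply not_all_ex_not in K2 as [f2 K2]. apply imply_to_and in K2 as [Hf2 K2].
  assert (B1 : forall eta, eta < lam -> exists x, x < g1 /\ eta < f1 x).
  { intros eta He. apply NNPP. intro Hn. apply K1. exists eta. split; auto.
    intros y Hy. exists y. repeat split; auto using le_refl. apply not_lt. eauto. }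
  destruct (choice (fun eta y => eta < lam -> y < g2 /\ forall x, y <= x -> x < g2 -> eta < f2 x)) as [beta Hb].
  { intro eta. destruct (classic (eta < lam)) as [He|He]; [|exists eta; tauto].
    apply NNPP. intro Hn. apply K2. exists eta. split; auto.
    intros y Hy. apply NNPP. intro Hn'. apply Hn. exists y. intros _. split; auto.
    intros x Hx1 Hx2. apply not_le. intro. apply Hn'. eauto. }
  apply (Hreg g1 Hlt). exists (fun i => beta (f1 i)). split.
  - intros x Hx. apply Hb. auto.
  - intros y Hy. destruct (B1 (f2 y)) as [x [Hx1 Hx2]]; auto. exists x. split; auto.
    apply not_lt. intro Hlt'. destruct (Hb (f1 x)) as [_ H]; auto.
    specialize (H y (or_introl Hlt') Hy). ord.
Qed.

Lemma pigeon_cofinal a g f : cofinal_in a g f -> pigeon g -> pigeon a.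
Proof.
  intros [H1 [H2 H3]] Hg k Hk.
  destruct (Hg (fun i => k (f i))) as [eta [He1 He2]]; auto.
  exists eta. split; auto. intros y Hy. destruct (H3 y Hy) as [i [Hi1 Hi2]].
  destruct (He2 i Hi1) as [j [Hj1 [Hj2 Hj3]]]. exists (f j). repeat split; auto.
  destruct Hj1 as [Hj1| <-]; auto. specialize (H2 i j Hj1 Hj2). ord.
Qed.

Definition uncountable_cof (a : T) : Prop :=
  forall f : nat -> T, (forall n, f n < a) -> exists z, z < a /\ forall n, f n < z.

Lemma reg_uncountable_cof g b : reg g -> b < g -> infinite lt b -> uncountable_cof g.
Proof.
  intros Hg Hb Hinf f Hf. apply infinite_iff in Hinf.
  destruct (emb_inverse _ _ 0 Hinf) as [k [_ Hk]].
  destruct (not_ub b g (fun x => f (k x))) as [z [Hz1 Hz2]]; auto.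
  exists z. split; auto. intro n. destruct (Hk n I) as [y [Hy <-]]. auto.
Qed.

Lemma uncountable_cof_cofinal a g f : cofinal_in a g f -> uncountable_cof g -> uncountable_cof a.
Proof.
  intros [H1 [H2 H3]] Hg s Hs.
  destruct (choice (fun n i => i < g /\ s n <= f i)) as [i Hi]; auto.
  destruct (Hg i) as [z [Hz1 Hz2]]; [apply Hi|].
  exists (f z). split; auto. intro n. destruct (Hi n) as [_ K]. specialize (H2 (i n) z (Hz2 n) Hz1). ord.
Qed.

(** * Limit points and order types *)

Definition unb (A : T -> Prop) (d : T) : Prop :=
  forall y, y < d -> exists x, A x /\ y < x /\ x < d.

Definition limit_point (A : T -> Prop) (d : T) : Prop := is_limit lt d /\ unb A d.

Lemma sup_unb A d : is_sup lt (fun x => A x /\ x < d) d <-> unb A d.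
Proof.
  split.
  - intros [_ H] y Hy. apply NNPP. intro K. assert (d <= y); [|ord].
    apply H. intros x [Hx1 Hx2]. apply not_lt. intro. apply K. eauto.
  - intro H. split.
    + intros x [_ Hx]. now left.
    + intros b Hb. apply not_lt. intro K. destruct (H b K) as [x [Hx1 [Hx2 Hx3]]].
      assert (x <= b) by auto. ord.
Qed.

(* [pos P x] is the order type of the elements of [P] below [x]. *)
Definition pos (P : T -> Prop) : T -> T :=
  epsilon (inhabits (fun x => x)) (is_rank (fun y x => y < x /\ P y)).

Lemma pos_wf (P : T -> Prop) : well_founded (fun y x => y < x /\ P y).
Proof.
  intro x. induction (lt_wf x) as [x _ IH]. constructor. intros y [Hy _]. auto.
Qed.

Lemma pos_rank P : is_rank (fun y x => y < x /\ P y) (pos P).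
Proof. unfold pos. apply epsilon_spec, rank_exists, pos_wf. Qed.

Lemma pos_le P x : pos P x <= x.
Proof.
  induction (lt_wf x) as [x _ IH]. apply (rank_spec _ _ x x (pos_rank P)).
  intros s [Hs _]. specialize (IH s Hs). ord.
Qed.

Lemma pos_lt P x y : y < x -> P y -> pos P y < pos P x.
Proof.
  intros H1 H2. apply (rank_spec _ _ x x (pos_rank P)); auto.
  intros s [Hs _]. pose proof (pos_le P s). ord.
Qed.

Lemma pos_bound (P : T -> Prop) x z : (forall y, y < x -> P y -> pos P y < z) -> pos P x <= z.
Proof. intro H. apply (rank_spec _ _ x z (pos_rank P)). intros s [? ?]; auto. Qed.

Lemma pos_mono P x y : y <= x -> pos P y <= pos P x.
Proof.
  intro H. apply pos_bound. intros z Hz1 Hz2. apply pos_lt; auto. ord.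
Qed.

Lemma pos_onto P x z : z < pos P x -> exists y, y < x /\ P y /\ pos P y = z.
Proof.
  intro Hz. destruct (rank_onto (fun y x => y < x /\ P y) (pos P) x z) as [y [[Hy1 Hy2] Hy3]];
    eauto using pos_wf, pos_rank.
  - intros u v w [? ?] [? ?]. split; auto. ord.
  - intros s [? ?]. now apply pos_lt.
Qed.

Lemma pos_sub (P Q : T -> Prop) x : (forall y, y < x -> P y -> Q y) -> pos P x <= pos Q x.
Proof.
  induction (lt_wf x) as [x _ IH]. intro H. apply pos_bound. intros y Hy1 Hy2.
  assert (pos P y <= pos Q y).
  { apply IH; auto. intros z Hz. apply H. ord. }
  assert (pos Q y < pos Q x) by (apply pos_lt; auto). ord.
Qed.

Lemma pos_ext (P Q : T -> Prop) x : (forall y, y < x -> P y <-> Q y) -> pos P x = pos Q x.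
Proof. intro H. apply le_antisym; apply pos_sub; intros y Hy; apply H; auto. Qed.

Lemma ub_cofinal a g s b : cofinal_in a g s -> ub b a -> ub b g.
Proof.
  intros [S1 [S2 S3]] [f [F1 F2]].
  destruct (choice (fun x i => x < b -> i < g /\ f x <= s i)) as [i Hi].
  { intro x. destruct (classic (x < b)) as [Hx|]; [|exists x; tauto].
    destruct (S3 (f x)) as [i Hi]; eauto. }
  exists i. split.
  - intros x Hx. now apply Hi.
  - intros y Hy. destruct (F2 (s y)) as [x [Hx1 Hx2]]; auto. exists x. split; auto.
    destruct (Hi x Hx1) as [H1 H2]. apply not_lt. intro K. specialize (S2 _ _ K Hy). ord.
Qed.

(** Together with [otp_not_ub]: the order type of an unbounded subset of [a] has the cofinality of
    [a]. This later distinguishes the order types chosen for different cofinalities. *)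
Lemma ub_otp P a g s : unb P a -> cofinal_in a g s -> ub g (pos P a).
Proof.
  intros HP [S1 [S2 S3]]. exists (fun i => pos P (s i)). split.
  - intros i Hi. destruct (HP (s i)) as [x [Hx1 [Hx2 Hx3]]]; auto.
    pose proof (pos_lt P a x Hx3 Hx1). assert (pos P (s i) <= pos P x) by (apply pos_mono; ord). ord.
  - intros y Hy. apply pos_onto in Hy as [x [Hx1 [Hx2 <-]]].
    destruct (S3 x Hx1) as [i [Hi1 Hi2]]. exists i. split; auto. now apply pos_mono.
Qed.

Lemma otp_not_ub P a g s b :
  unb P a -> cofinal_in a g s -> reg g -> b < g -> ~ ub b (pos P a).
Proof.
  intros HP Hs Hreg Hb [f [F1 F2]]. apply (Hreg b Hb). apply (ub_cofinal a g s); auto.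
  destruct (choice (fun i x => i < b -> x < a /\ P x /\ pos P x = f i)) as [h Hh].
  { intro i. destruct (classic (i < b)) as [Hi|]; [|exists i; tauto].
    destruct (pos_onto P a (f i)) as [x Hx]; eauto. }
  exists h. split; [intros; now apply Hh|].
  intros y Hy. destruct (HP y Hy) as [x [Hx1 [Hx2 Hx3]]].
  destruct (F2 (pos P x)) as [i [Hi1 Hi2]]; [now apply pos_lt|].
  exists i. split; auto. destruct (Hh i Hi1) as [H1 [H2 H3]].
  apply not_lt. intro K. assert (h i < x) by ord.
  assert (pos P (h i) < pos P x) by now apply pos_lt. rewrite H3 in *. ord.
Qed.

(** One [eta] bounds [pos P] at cofinally many points, hence everywhere below [a] by
    monotonicity. *)
Lemma pigeon_otp P a : unb P a -> (forall x, P x -> x < a -> pos P x < lam) -> pigeon a -> pos P a < lam.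
Proof.
  intros HP Hl Hp. destruct (Hp (pos P)) as [eta [E1 E2]].
  - intros x Hx. destruct (HP x Hx) as [y [Hy1 [Hy2 Hy3]]]. specialize (Hl y Hy1 Hy3).
    assert (pos P x <= pos P y) by (apply pos_mono; ord). ord.
  - assert (pos P a <= eta); [|ord]. apply pos_bound. intros y Hy1 Hy2.
    destruct (HP y Hy1) as [z [Hz1 [Hz2 Hz3]]]. destruct (E2 z Hz3) as [x [Hx1 [Hx2 Hx3]]].
    assert (pos P y < pos P z) by now apply pos_lt.
    assert (pos P z <= pos P x) by now apply pos_mono. ord.
Qed.

(** * Square sequences and their refinement *)

(** [square_seq] with order type measured by [pos] and closure by limit points, and with [C a]
    inside [a] also at nonlimit [a]. *)
Definition is_square (C : T -> T -> Prop) : Prop :=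
  (forall a x, C a x -> x < a) /\
  forall a, is_limit lt a ->
    unb (C a) a /\
    (forall d, d < a -> limit_point (C a) d -> C a d) /\
    (forall d, C a d -> limit_point (C a) d -> forall x, C d x <-> C a x /\ x < d) /\
    (forall x, C a x -> pos (C a) x < lam).

Lemma is_square_of_square_seq C : square_seq lt lam C -> is_square (fun a x => C a x /\ x < a).
Proof.
  intro H. split; [tauto|]. intros a Ha. destruct (H a Ha) as [[H1 [H2 H3]] [[f Hf] H5]].
  assert (Hu : forall d, limit_point (fun x => C a x /\ x < a) d -> is_limit lt d /\ unb (C a) d).
  { intros d [K1 K2]. split; auto. intros y Hy. destruct (K2 y Hy) as [x [[? _] ?]]. eauto. }
  split; [|split; [|split]].
  - intros y Hy. destruct (proj2 Ha y Hy) as [y' [Hy1 Hy2]]. destruct (H2 y' Hy2) as [x [Hx1 Hx2]].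
    exists x. repeat split; auto. ord.
  - intros d Hd Hlp. apply Hu in Hlp as [K1 K2]. split; auto. apply H3; auto. now apply sup_unb.
  - intros d [Hd Hda] Hlp x. apply Hu in Hlp as [K1 K2].
    rewrite (H5 d); [|split; auto; now apply sup_unb]. split; [|tauto].
    intros [[? ?] _]. repeat split; auto.
  - intros x [Hx Hxa].
    (* An order-preserving map into [lam] dominates [pos] pointwise. *)
    assert (K : forall z, (forall h : C a z, pos (fun x => C a x /\ x < a) z <= proj1_sig (f (exist _ z h)))).
    { intro z. induction (lt_wf z) as [z _ IH]. intro h. apply pos_bound. intros y Hy [Hy1 Hy2].
      specialize (IH y Hy Hy1). specialize (Hf (exist _ y Hy1) (exist _ z h) Hy). ord. }
    specialize (K x Hx). pose proof (proj2_sig (f (exist _ x Hx))). simpl in *. ord.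
Qed.

Lemma square_seq_of_is_square C : is_square C -> square_seq lt lam C.
Proof.
  intros [H0 H] a Ha. destruct (H a Ha) as [H1 [H2 [H3 H4]]]. split; [|split].
  - split; [auto|split].
    + intros y Hy. destruct (H1 y Hy) as [x [? [? ?]]]. exists x. split; auto. now left.
    + intros g Hg Hlim Hsup. apply H2; auto. split; auto. now apply sup_unb.
  - exists (fun x => exist (fun y => y < lam) (pos (C a) (proj1_sig x)) (H4 _ (proj2_sig x))).
    intros [x hx] [y hy] Hxy. simpl in *. now apply pos_lt.
  - intros b [Hb1 Hb2] x. apply sup_unb in Hb2.
    (* [acc] admits the least element of [T], which is no limit; both sides are then empty. *)
    destruct (classic (exists y, y < b)) as [He|He].
    + apply H3; auto. split; auto. split; auto.
      intros y Hy. destruct (Hb2 y Hy) as [z [? ?]]. eauto.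
    + split; [intro K; apply H0 in K|intros [_ K]]; exfalso; eauto.
Qed.

(* The closure of [F a] when that is unbounded, otherwise the part of [C a] above it: either way
   coherence is kept. *)
Definition refine (C F : T -> T -> Prop) (a x : T) : Prop :=
  C a x /\
  (unb (F a) a /\ (F a x \/ limit_point (F a) x) \/
   ~ unb (F a) a /\ forall z, F a z -> z <= x).

Lemma unb_refine (C F : T -> T -> Prop) a d :
  unb (F a) a -> unb (refine C F a) d -> unb (F a) d.
Proof.
  intros Hu H y Hy. destruct (H y Hy) as [x [[_ [[_ [K|[_ K]]]|[K _]]] [H1 H2]]]; [now exists x| |tauto].
  destruct (K y H1) as [z [? [? ?]]]. exists z. repeat split; auto. ord.
Qed.

Lemma limit_point_sub A B d : (forall x, A x -> B x) -> limit_point A d -> limit_point B d.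
Proof.
  intros H [K1 K2]. split; auto. intros y Hy. destruct (K2 y Hy) as [x [? ?]]. eauto.
Qed.

Lemma limit_point_below A B d : (forall x, x < d -> A x -> B x) -> limit_point A d -> limit_point B d.
Proof.
  intros H [K1 K2]. split; auto. intros y Hy. destruct (K2 y Hy) as [x [? [? ?]]]. eauto.
Qed.

Definition coherent (C F : T -> T -> Prop) : Prop :=
  (forall a x, F a x -> C a x) /\
  forall a d, is_limit lt a -> C a d -> limit_point (C a) d -> forall x, F d x <-> F a x /\ x < d.

(** The same case of [refine] applies at [d] as at [a]. If [F a] is unbounded, limit points of the
    refinement are limits of [F a]; if not, the refinement starts above [F a], and [F d] is bounded
    in [d]. *)
Lemma refine_bounded (C F : T -> T -> Prop) a d : is_square C -> coherent C F ->
  is_limit lt a -> refine C F a d -> limit_point (refine C F a) d -> (unb (F d) d <-> unb (F a) a).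
Proof.
  intros HC [HF1 HF2] Ha Hd Hlp.
  assert (HFd : forall x, F d x <-> F a x /\ x < d).
  { apply HF2; auto; [apply Hd|]. revert Hlp. apply limit_point_sub. intros x Hx; apply Hx. }
  split; intro H.
  - apply NNPP. intro K.
    destruct Hlp as [[[y Hy] _] Hlp]. destruct (Hlp y Hy) as [x [[_ [[? _]|[_ Hx]]] [_ Hxd]]]; [tauto|].
    destruct (H x Hxd) as [z [Hz1 [Hz2 _]]]. apply HFd in Hz1 as [Hz1 _]. specialize (Hx z Hz1). ord.
  - intros y Hy. destruct (unb_refine C F a d H (proj2 Hlp) y Hy) as [x [? [? ?]]].
    exists x. repeat split; auto. now apply HFd.
Qed.

Lemma refine_square (C F : T -> T -> Prop) : is_square C -> coherent C F -> is_square (refine C F).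
Proof.
  intros HC HF. pose proof (fun a d => refine_bounded C F a d HC HF) as Hbd.
  destruct HC as [H0 H], HF as [HF1 HF2]. split.
  { intros a x [Hx _]. auto. }
  assert (Hsub : forall a x, refine C F a x -> C a x) by (intros a x Hx; apply Hx).
  intros a Ha. destruct (H a Ha) as [H1 [H2 [H3 H4]]]. split; [|split; [|split]].
  - intros y Hy. destruct (classic (unb (F a) a)) as [K|K].
    + destruct (K y Hy) as [x [? [? ?]]]. exists x. repeat split; auto.
    + assert (exists y0, y0 < a /\ y <= y0 /\ forall z, F a z -> z <= y0) as [y0 [Y1 [Y2 Y3]]].
      { apply not_all_ex_not in K as [y1 K]. apply imply_to_and in K as [Hy1 K].
        assert (K' : forall z, F a z -> z <= y1).
        { intros z Hz. apply not_lt. intro. apply K. exists z. repeat split; auto. }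
        destruct (classic (y <= y1)) as [L|L]; [exists y1|exists y]; repeat split; auto using le_refl.
        intros z Hz. specialize (K' z Hz). ord. }
      destruct (H1 y0 Y1) as [x [X1 [X2 X3]]]. exists x. repeat split; auto; try ord.
      right. split; auto. intros z Hz. specialize (Y3 z Hz). ord.
  - intros d Hd Hlp. split.
    + apply H2; auto. revert Hlp. apply limit_point_sub. auto.
    + destruct (classic (unb (F a) a)) as [K|K].
      * left. split; auto. right. split; [apply Hlp|]. apply (unb_refine C F a d); auto. apply Hlp.
      * right. split; auto. intros z Hz. destruct Hlp as [[[y Hy] _] Hlp].
        destruct (Hlp y Hy) as [x [[_ [[? _]|[_ Hx]]] [_ Hxd]]]; [tauto|].
        specialize (Hx z Hz). ord.
  - intros d Hd Hlp x.
    assert (Hlp' : limit_point (C a) d) by (revert Hlp; apply limit_point_sub; auto).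
    specialize (Hbd a d Ha Hd Hlp).
    pose proof (H3 d (Hsub _ _ Hd) Hlp') as HCd.
    pose proof (HF2 a d Ha (Hsub _ _ Hd) Hlp') as HFd.
    unfold refine. rewrite Hbd, HCd, HFd. clear Hbd.
    assert (L : x < d -> (limit_point (F d) x <-> limit_point (F a) x)).
    { intro Hx. split; apply limit_point_below; intros z Hz K; apply HFd; auto.
      split; auto. ord. }
    (* In the tail case all of [F a] lies below [d], so [F d] and [F a] impose the same lower
       bound. *)
    assert (B : ~ unb (F a) a -> forall z, F a z -> z < d).
    { intros K z Hz. destruct Hlp as [[[y Hy] _] Hlp].
      destruct (Hlp y Hy) as [u [[_ [[? _]|[_ Hu]]] [_ Hud]]]; [tauto|].
      specialize (Hu z Hz). ord. }
    split.
    + intros [[K1 K2] K3]. split; [split; [exact K1|]|exact K2].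
      destruct K3 as [[K3 [K4|K4]]|[K3 K4]]; [left; tauto|left; tauto|right].
      split; auto. intros z Hz. apply K4, HFd. auto.
    + intros [[K1 K3] K2]. split; [split; assumption|].
      destruct K3 as [[K3 [K4|K4]]|[K3 K4]]; [left; tauto|left; tauto|right].
      split; auto. intros z Hz. apply HFd in Hz. apply K4. tauto.
  - intros x Hx. specialize (H4 x (Hsub _ _ Hx)).
    assert (pos (refine C F a) x <= pos (C a) x) by (apply pos_sub; auto). ord.
Qed.

(** * Closure points in place of clubs *)

(** Clubs are represented by functions: each club contains the closure points of some [G]
    ([club_closed_under]). *)
Definition closed_under (G : T -> T) (b : T) : Prop :=
  is_limit lt b /\ forall x, x < b -> G x < b.

Lemma closed_under_mono G G' b : (forall x, G x <= G' x) -> closed_under G' b -> closed_under G b.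
Proof.
  intros H [K1 K2]. split; auto. intros x Hx. specialize (K2 x Hx). specialize (H x). ord.
Qed.

(** Replaces the intersection of [lam] many clubs. *)
Lemma dominate_family {A : Type} (P : A -> Prop) (G : A -> T -> T) :
  emb P (below lam) -> exists G', forall i x, P i -> G i x < G' x.
Proof.
  intro H. destruct (choice (fun x z => forall i, P i -> G i x < z)) as [G' HG'].
  { intro x. now apply bounded. }
  exists G'. auto.
Qed.

Lemma dominate_monotone (G : T -> T) : exists G', forall x y, y <= x -> G y < G' x /\ x < G' x.
Proof.
  destruct (choice (fun x z => forall y, y <= x -> G y < z /\ x < z)) as [G' HG']; [|now exists G'].
  intro x. destruct (no_max x) as [x' Hx'].
  destruct (bounded (below x') G (emb_below_lam x')) as [z Hz].
  destruct (classic (x < z)) as [K|K].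
  - exists z. intros y Hy. split; auto. apply Hz. ord.
  - exists x'. intros y Hy. split; auto. apply not_lt in K. assert (G y < z) by (apply Hz; ord). ord.
Qed.

Lemma club_closed_under D : club lt D -> exists G, forall b, closed_under G b -> D b.
Proof.
  intros [D1 D2]. destruct (choice (fun x d => D d /\ x < d)) as [G HG].
  { intro x. destruct (no_max x) as [y Hy]. destruct (D1 y) as [d [? ?]]. exists d. split; auto. ord. }
  exists G. intros b [B1 B2]. apply D2; auto. apply sup_unb.
  intros y Hy. exists (G y). destruct (HG y). auto.
Qed.

Lemma regular_is_limit g : is_regular lt g -> is_limit lt g.
Proof.
  intros Hg. pose proof (reg_of_regular g Hg) as Hreg. destruct Hg as [Hinf _].
  apply infinite_iff in Hinf as [f [Hf If]]. split; [exists (f 0); auto|].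
  intros x Hx. apply NNPP. intro K.
  assert (Hle : forall y, y < g -> y <= x) by (intros; apply not_lt; eauto).
  destruct (classic (exists y, y < x)) as [[y0 Hy0]|He].
  - apply (Hreg x Hx). exists (fun _ => x). split; auto. intros y Hy. exists y0. auto.
  - assert (f 0 = f 1) as E; [|apply If in E; auto; discriminate].
    destruct (Hle (f 0)), (Hle (f 1)); auto; try (exfalso; eauto; fail). congruence.
Qed.

(** [s] climbs for [g] steps past [G'] of all earlier values. The supremum [a] is closed under [G],
    and regularity of [g] gives it cofinality exactly [g]. *)
Lemma cofinality_stationary g G : is_regular lt g -> exists a, closed_under G a /\ cf_is lt a g.
Proof.
  intros Hg. pose proof (regular_is_limit g Hg) as [[x0 Hx0] Hlim].
  destruct (dominate_monotone G) as [G' HG'].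
  destruct (wf_rec lt lam (fun i p => mu (fun z => forall j, j < i -> G' (p j) < z)) lt_wf) as [s Hs].
  { intros i p q E. f_equal. extensionality z. apply propositional_extensionality.
    split; intros K j Hj; [rewrite <- E|rewrite E]; auto. }
  assert (M : forall i, (forall j, j < i -> G' (s j) < mu (fun z => forall j, j < i -> G' (s j) < z)) /\
     forall z, (forall j, j < i -> G' (s j) < z) -> mu (fun z => forall j, j < i -> G' (s j) < z) <= z).
  { intro i. apply (mu_spec (fun z => forall j, j < i -> G' (s j) < z)).
    apply (bounded (below i) (fun j => G' (s j))), emb_below_lam. }
  assert (Hinc : forall i j, j < i -> G' (s j) < s i).
  { intros i j Hj. rewrite (Hs i). now apply M. }
  destruct (M g) as [M1 M2]. set (a := mu (fun z => forall j, j < g -> G' (s j) < z)) in *.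
  assert (Hid : forall x, x < G' x) by (intro x; apply (HG' x x), le_refl).
  assert (Hcov : forall y, y < a -> exists j, j < g /\ y < s j).
  { intros y Hy. assert (exists j, j < g /\ y <= G' (s j)) as [j [J1 J2]].
    { apply NNPP. intro K. assert (a <= y); [|ord]. apply M2. intros j Hj. apply not_le. eauto. }
    destruct (Hlim j J1) as [j' [J3 J4]]. exists j'. split; auto. specialize (Hinc j' j J3). ord. }
  assert (Hcof : cofinal_in a g s).
  { split; [|split].
    - intros j Hj. specialize (M1 j Hj). specialize (Hid (s j)). ord.
    - intros j i Hj _. specialize (Hinc i j Hj). specialize (Hid (s j)). ord.
    - intros y Hy. destruct (Hcov y Hy) as [j [? ?]]. exists j. split; auto. now left. }
  exists a. split; [split; [split|]|split].
  - exists (s x0). now apply Hcof.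
  - intros y Hy. destruct (Hcov y Hy) as [j [? ?]]. exists (s j). split; auto. now apply Hcof.
  - intros y Hy. destruct (Hcov y Hy) as [j [J1 J2]]. specialize (M1 j J1).
    assert (G y < G' (s j)) by (apply HG'; now left). ord.
  - apply cof_map_iff. eauto.
  - intros b Hb K. apply cof_map_ub in K. apply (reg_of_regular g Hg b Hb).
    now apply (ub_cofinal a g s).
Qed.

(** Iterates [Q] omega times from [x0]; uncountable cofinality keeps the supremum [d] below [a]. *)
Lemma sequence_limit (Q : T -> T -> Prop) a x0 :
  uncountable_cof a -> x0 < a -> (forall x, x < a -> exists y, Q x y /\ x < y /\ y < a) ->
  exists d, x0 < d /\ d < a /\ is_limit lt d /\
    forall y, y < d -> exists u v, Q u v /\ y < u /\ u < v /\ v < d.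
Proof.
  intros Ha Hx0 HQ.
  destruct (choice (fun x y => x < a -> Q x y /\ x < y /\ y < a)) as [h Hh].
  { intro x. destruct (classic (x < a)) as [Hx|]; [|exists x; tauto].
    destruct (HQ x Hx) as [y Hy]. eauto. }
  set (s := fix s n := match n with O => x0 | S n => h (s n) end).
  assert (Hs : forall n, s n < a) by (induction n; simpl; auto; now apply Hh).
  assert (Hinc : forall n, Q (s n) (s (S n)) /\ s n < s (S n)).
  { intro n. specialize (Hs n). apply Hh in Hs. simpl. tauto. }
  destruct (Ha s Hs) as [z [Hz1 Hz2]].
  destruct (mu_spec (fun z => forall n, s n < z)) as [M1 M2]; [eauto|].
  set (d := mu (fun z => forall n, s n < z)) in *.
  assert (Hcov : forall y, y < d -> exists n, y < s n).
  { intros y Hy. assert (exists n, y <= s n) as [n Hn].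
    { apply NNPP. intro K. assert (d <= y); [|ord]. apply M2. intro n. apply not_le. eauto. }
    exists (S n). destruct (Hinc n). ord. }
  exists d. repeat split.
  - apply (M1 0).
  - specialize (M2 z Hz2). ord.
  - exists x0. apply (M1 0).
  - intros y Hy. destruct (Hcov y Hy) as [n Hn]. eauto.
  - intros y Hy. destruct (Hcov y Hy) as [n Hn]. exists (s n), (s (S n)).
    destruct (Hinc n). auto.
Qed.

(** A chain in [K], each member beyond [G'] of the previous one, has a supremum that is in [K] by
    closedness and closed under [G]. *)
Lemma closed_under_dense (K : T -> Prop) G G' a :
  (forall x y, y <= x -> G y < G' x /\ x < G' x) ->
  uncountable_cof a -> unb K a -> (forall d, d < a -> limit_point K d -> K d) ->
  closed_under G' a -> unb (fun b => K b /\ closed_under G b) a.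
Proof.
  intros HG Ha HK Hcl [Hlim HaG] y Hy.
  destruct (sequence_limit (fun u v => K v /\ G' u < v) a y Ha Hy) as [d [D1 [D2 [D3 D4]]]].
  { intros x Hx. destruct (HK (G' x)) as [z [Z1 [Z2 Z3]]]; auto.
    destruct (HG x x (le_refl _)). exists z. repeat split; auto. ord. }
  exists d. repeat split; auto; try apply D3.
  - apply Hcl; auto. split; auto. intros x Hx. destruct (D4 x Hx) as [u [v [[? ?] [? [? ?]]]]].
    exists v. repeat split; auto. ord.
  - intros x Hx. destruct (D4 x Hx) as [u [v [[? ?] [? [? ?]]]]].
    assert (G x < G' u) by (apply HG; now left). ord.
Qed.

(** * A guess for points of one cofinality *)

(** [R b' b Z] proposes [Z] as the trace of [A] on [b'], while [b] testifies to closure under [G].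
    Proposals must be cofinal, and all of them correct. *)
Definition guesses (C : T -> Prop) (R : T -> T -> (T -> Prop) -> Prop)
    (G : T -> T) (A : T -> Prop) (a : T) : Prop :=
  (forall x, x < a -> exists b' b Z, x < b' /\ C b' /\ C b /\ R b' b Z) /\
  (forall b' b Z, C b' -> C b -> R b' b Z ->
     closed_under G b /\ forall x, x < b' -> (Z x <-> A x)).

Lemma max_below a b m : a < m -> b < m -> exists c, c < m /\ a <= c /\ b <= c.
Proof.
  intros Ha Hb. destruct (classic (a <= b)) as [K|K]; [exists b|exists a]; repeat split; auto using le_refl.
  apply not_le in K. now left.
Qed.

Lemma guess_family (Hch : CH lt lam) (C : T -> T -> Prop) (S : T -> Prop) :
  (forall a, S a -> unb (C a) a /\ (forall d, d < a -> limit_point (C a) d -> C a d) /\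
     uncountable_cof a /\ pigeon a /\ exists m, m < lam /\ emb (C a) (below m)) ->
  (forall G, exists a, S a /\ closed_under G a) ->
  exists R : T -> T -> (T -> Prop) -> Prop,
    (forall b' b Z, R b' b Z -> b' < b) /\
    forall G A, exists a, S a /\ guesses (C a) R G A a.
Proof.
  intros HS Hst. apply NNPP. intro Hno.
  (* [F] will pick for each guess a function and a set that defeat it throughout [S]; the value is
     arbitrary when [R] violates [b' < b]. *)
  assert (HF : forall R : T -> T -> (T -> Prop) -> Prop, exists GA : (T -> T) * (T -> Prop),
    (forall b' b Z, R b' b Z -> b' < b) -> forall a, S a -> ~ guesses (C a) R (fst GA) (snd GA) a).
  { intro R. apply NNPP. intro K. apply Hno. exists R. split.
    - apply NNPP. intro K'. apply K. exists (fun x => x, fun _ => True). tauto.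
    - intros G A. apply NNPP. intro K'. apply K. exists (G, A). intros _ a Ha Hg. apply K'. eauto. }
  apply choice in HF as [F HF].
  destruct Hch as [h Hh].
  (* Predicates are restricted to [lam] before CH codes them, so equal codes give agreement only
     below [lam]. *)
  set (code := fun B : T -> Prop => h (fun u => B (proj1_sig u))).
  assert (Hcode : forall B B', code B = code B' -> forall u, u < lam -> (B u <-> B' u)).
  { intros B B' E u Hu. apply Hh in E. apply (f_equal (fun k => k (exist _ u Hu))) in E. simpl in E.
    now rewrite E. }
  destruct (choice (fun b (e : T -> T) => (forall x, x < b -> e x < lam) /\
    forall x y, x < b -> y < b -> e x = e y -> x = y) emb_below_lam) as [e He].
  destruct (hessenberg lam lam_infinite) as [pr [Hpr1 Hpr2]].
  (* Numbers triples of row, column and point below [lam], so that a matrix of sets becomes one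
     subset of [lam]. *)
  set (key := fun eta tau v => pr (eta, pr (tau, v))).
  assert (Hkey : forall eta tau v, eta < lam -> tau < lam -> v < lam -> key eta tau v < lam).
  { intros. apply Hpr1. split; simpl; auto. apply Hpr1. split; auto. }
  assert (Hkey_inj : forall eta tau v eta' tau' v', eta < lam -> tau < lam -> v < lam ->
    eta' < lam -> tau' < lam -> v' < lam -> key eta tau v = key eta' tau' v' ->
    eta = eta' /\ tau = tau' /\ v = v').
  { intros eta tau v eta' tau' v' ? ? ? ? ? ? E.
    apply Hpr2 in E; try (split; simpl; auto; apply Hpr1; split; simpl; auto).
    injection E as E1 E2. apply Hpr2 in E2; try (split; simpl; auto).
    injection E2 as E2 E3. auto. }
  set (Dec := fun c b' eta tau x => exists B, code B = c /\ B (key eta tau (e b' x))).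
  (* [p] lists the counterexamples. Column [tau] is proposed only if [c] decodes all earlier sets
     correctly on [b'] and [b] is closed under all earlier functions. *)
  set (RR := fun eta tau (p : T -> (T -> T) * (T -> Prop)) b' b (Z : T -> Prop) =>
    b' < b /\ exists c, c < b /\ e b c <= eta /\
      (forall sigma, sigma < tau -> closed_under (fst (p sigma)) b /\
         forall x, x < b' -> (Dec c b' eta sigma x <-> snd (p sigma) x)) /\
      Z = Dec c b' eta tau).
  (* The [tau]-th counterexample defeats the guess built from the earlier ones; the recursion is
     sound as [RR eta tau] reads [p] only below [tau]. *)
  assert (Hrec : forall eta, exists p, forall tau, p tau = F (RR eta tau p)).
  { intro eta. apply (wf_rec lt (fun x => x, fun _ => True) (fun tau p => F (RR eta tau p)) lt_wf).
    assert (Himp : forall tau p q b' b Z, (forall s, s < tau -> p s = q s) ->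
      RR eta tau p b' b Z -> RR eta tau q b' b Z).
    { intros tau p q b' b Z E [K1 [c [K2 [K3 [K4 K5]]]]]. split; auto. exists c.
      split; auto. split; auto. split; auto. intros sigma Hs. rewrite <- (E sigma Hs). auto. }
    intros tau p q E. f_equal. extensionality b'. extensionality b. extensionality Z.
    apply propositional_extensionality.
    split; apply Himp; auto. intros; symmetry; auto. }
  apply choice in Hrec as [P HP].
  (* [cc b'] codes the traces on [b'] of all the sets [snd (P eta tau)]. *)
  set (cc := fun b' => code (fun u => exists eta tau x, eta < lam /\ tau < lam /\ x < b' /\
    u = key eta tau (e b' x) /\ snd (P eta tau) x)).
  assert (Hcc : forall b' eta tau x, eta < lam -> tau < lam -> x < b' ->
    (Dec (cc b') b' eta tau x <-> snd (P eta tau) x)).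
  { intros b' eta tau x H1 H2 H3.
    assert (Hex : e b' x < lam) by now apply He.
    split.
    - intros [B [HB1 HB2]]. apply Hcode with (u := key eta tau (e b' x)) in HB1; auto.
      apply HB1 in HB2 as [eta' [tau' [x' [K1 [K2 [K3 [K4 K5]]]]]]].
      apply Hkey_inj in K4 as [-> [-> K4]]; auto; [|now apply He].
      apply He in K4; auto. now subst.
    - intro K. eexists. split; [reflexivity|]. exists eta, tau, x. auto. }
  (* [G1] handles all counterexample functions at once, [G2] also exceeds the codes [cc x], and [G3]
     adds the domination that [closed_under_dense] asks for. *)
  destruct (dominate_family (sq (below lam)) (fun p => fst (P (fst p) (snd p)))) as [G1 HG1];
    [apply hessenberg, lam_infinite|].
  destruct (choice (fun x z => G1 x <= z /\ cc x < z)) as [G2 HG2].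
  { intro x. destruct (no_max (cc x)) as [y Hy], (classic (G1 x <= y)) as [K|K].
    - exists y. auto.
    - apply not_le in K. exists (G1 x). split; [apply le_refl|ord]. }
  destruct (dominate_monotone G2) as [G3 HG3].
  destruct (Hst G3) as [a [Ha HaG]].
  destruct (HS a Ha) as [Hunb [Hcl [Huc [Hpig [m [Hm Hemb]]]]]].
  pose proof (closed_under_dense (C a) G2 G3 a HG3 Huc Hunb Hcl HaG) as Hdense.
  assert (Hpairs : forall x, exists q, x < a -> x < fst q /\ fst q < snd q /\
    C a (fst q) /\ C a (snd q) /\ closed_under G2 (snd q) /\ cc (fst q) < snd q).
  { intro x. destruct (classic (x < a)) as [Hx|]; [|exists (x, x); tauto].
    destruct (Hunb x Hx) as [b' [B1 [B2 B3]]]. destruct (Hdense b' B3) as [b [[B4 B5] [B6 B7]]].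
    exists (b', b). simpl. intros _. repeat split; auto; try apply B5.
    destruct B5 as [_ B5]. specialize (B5 b' B6). destruct (HG2 b'). ord. }
  apply choice in Hpairs as [q Hq].
  (* Cofinally many of the codes [cc b'] have number at most [eta] below their [b]; this fixes the
     row. *)
  destruct (Hpig (fun x => e (snd (q x)) (cc (fst (q x))))) as [eta [Heta Hcof]].
  { intros x Hx. apply He. now apply Hq. }
  (* The true codes [cc b'] yield cofinally many proposals of [RR eta tau], so its defeat at [a]
     must come from an incorrect one. [w tau] records it: correct before [tau], wrong at [tau]. *)
  assert (Hw : forall tau, exists w : T * T * T, tau < lam ->
    let '(b', b, c) := w in C a b' /\ C a b /\ c < b /\ e b c <= eta /\
      (forall sigma, sigma < tau -> closed_under (fst (P eta sigma)) b /\
         forall x, x < b' -> (Dec c b' eta sigma x <-> snd (P eta sigma) x)) /\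
      ~ (closed_under (fst (P eta tau)) b /\
         forall x, x < b' -> (Dec c b' eta tau x <-> snd (P eta tau) x))).
  { intro tau. destruct (classic (tau < lam)) as [Htau|]; [|exists (tau, tau, tau); tauto].
    apply NNPP. intro K. apply (HF (RR eta tau (P eta))) with a; auto.
    { intros b' b Z HR. apply HR. }
    rewrite <- HP. split.
    - intros x Hx. destruct (Hcof x Hx) as [y [Y1 [Y2 Y3]]].
      destruct (Hq y Y2) as [Q1 [Q2 [Q3 [Q4 [Q5 Q6]]]]].
      exists (fst (q y)), (snd (q y)), (Dec (cc (fst (q y))) (fst (q y)) eta tau).
      split; [ord|]. split; auto. split; auto. split; auto.
      exists (cc (fst (q y))). split; auto. split; auto. split; auto.
      intros sigma Hsigma. assert (sigma < lam) by ord. split.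
      + apply closed_under_mono with G2; auto. intro z.
        assert (fst (P eta sigma) z < G1 z) by (apply (HG1 (eta, sigma) z); split; auto).
        destruct (HG2 z). ord.
      + intros z Hz. apply Hcc; auto.
    - intros b' b Z Hb' Hb [Hlt [c [Hc1 [Hc2 [Hc3 ->]]]]]. apply NNPP. intro K'. apply K.
      exists (b', b, c). intros _. auto 8. }
  apply choice in Hw as [w Hw].
  (* The triple of [tau] is correct at the earlier column [tau'], where that of [tau'] is wrong. *)
  assert (Hdiff : forall tau tau', tau < lam -> tau' < tau -> w tau <> w tau').
  { intros tau tau' H1 H2 E. assert (H3 : tau' < lam) by ord.
    specialize (Hw tau H1) as W1. specialize (Hw tau' H3) as W2. rewrite E in W1.
    destruct (w tau') as [[b' b] c]. destruct W1 as [_ [_ [_ [_ [W1 _]]]]].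
    destruct W2 as [_ [_ [_ [_ [_ W2]]]]]. auto. }
  destruct omega_below as [w0 [Hw0 Hw0']].
  (* [M] will dominate [m], [eta] and omega, so that fewer than [lam] triples are available. *)
  destruct (max_below m eta lam Hm Heta) as [M1 [L1 [L2 L3]]].
  destruct (max_below M1 w0 lam L1 Hw0) as [M [L4 [L5 L6]]].
  assert (HMinf : infinite lt M) by now apply (infinite_mono w0).
  apply (lam_not_emb M L4).
  apply emb_trans with (sq (below M)); [|now apply hessenberg].
  apply emb_trans with (sq (sq (below M))); [|now apply emb_sq, hessenberg].
  apply emb_trans with (sq (sq (fun x => x <= M))); [|now apply emb_sq, emb_sq, emb_le].
  destruct Hemb as [j [Hj Ij]].
  (* [c] is recovered from its number [e b c], entered twice so that a triple becomes a pair of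
     pairs. *)
  exists (fun tau => let '(b', b, c) := w tau in ((j b', j b), (e b c, e b c))). split.
  - intros tau Htau. specialize (Hw tau Htau). destruct (w tau) as [[b' b] c].
    destruct Hw as [W1 [W2 [_ [W3 _]]]]. apply Hj in W1, W2.
    repeat split; simpl; ord.
  - intros tau tau' H1 H2 E.
    assert (w tau = w tau') as E'.
    { specialize (Hw tau H1) as W1. specialize (Hw tau' H2) as W2.
      destruct (w tau) as [[b' b] c], (w tau') as [[d' d] c'].
      destruct W1 as [A1 [A2 [A3 _]]], W2 as [B1 [B2 [B3 _]]].
      injection E as E1 E2 E3. apply Ij in E1; auto. apply Ij in E2; auto. subst.
      apply He in E3; auto. now subst. }
    destruct (lt_total tau tau') as [K|[K|K]]; auto; exfalso; eapply Hdiff; try exact K; eauto.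
Qed.

(** * From coherent guesses to the sets [S a] *)

(** [C] is refined by the limit points below which proposals are cofinal. Where the guess succeeds
    these are closed under [G], being limits of such [b]; constancy of [RR] along [C] makes the
    refinement coherent. *)
Lemma diamond_of_guesses (C : T -> T -> Prop) (RR : T -> T -> T -> (T -> Prop) -> Prop) :
  is_square C -> (forall a b' b Z, RR a b' b Z -> b' < b) ->
  (forall a d, is_limit lt a -> C a d -> limit_point (C a) d -> RR d = RR a) ->
  exists C2 S, is_square C2 /\ (forall a x, S a x -> x < a) /\
    (forall a d, is_limit lt a -> C2 a d -> limit_point (C2 a) d -> forall x, S d x <-> S a x /\ x < d) /\
    forall a G A, is_limit lt a -> uncountable_cof a -> guesses (C a) (RR a) G A a ->
      (forall x, C2 a x -> closed_under G x) /\ (forall x, S a x <-> A x /\ x < a) /\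
      unb (fun d => C2 a d /\ limit_point (C2 a) d) a.
Proof.
  intros HC HRlt HRcoh.
  set (trip := fun a b' b Z => C a b' /\ C a b /\ RR a b' b Z).
  set (Acc := fun a d => C a d /\ limit_point (C a) d /\
    forall x, x < d -> exists b' b Z, trip d b' b Z /\ x < b').
  (* Since [b' < b], passing from [a] to [d] only cuts off [b]. *)
  assert (Htrip : forall a d, is_limit lt a -> C a d -> limit_point (C a) d ->
    forall b' b Z, trip d b' b Z <-> trip a b' b Z /\ b < d).
  { intros a d H1 H2 H3 b' b Z. destruct HC as [_ HC]. destruct (HC a H1) as [_ [_ [Hc _]]].
    specialize (Hc d H2 H3). unfold trip. rewrite (HRcoh a d H1 H2 H3), !Hc.
    split; [tauto|]. intros [[K1 [K2 K3]] K4]. repeat split; auto.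
    apply HRlt in K3. ord. }
  assert (Hcoh : coherent C Acc).
  { split; [intros a x Hx; apply Hx|]. intros a d H1 H2 H3 x. destruct HC as [_ HC].
    destruct (HC a H1) as [_ [_ [Hc _]]]. specialize (Hc d H2 H3). unfold Acc. rewrite Hc.
    split.
    - intros [[K1 K2] [K3 K4]]. split; auto. split; auto. split; auto.
      revert K3. apply limit_point_sub. intros y. rewrite Hc. tauto.
    - intros [[K1 [K2 K3]] K4]. split; auto. split; auto.
      revert K2. apply limit_point_below. intros y Hy. rewrite Hc. split; auto. ord. }
  assert (Htrip_Acc : forall a d x, is_limit lt a -> Acc a d -> x < d ->
    exists b' b Z, trip a b' b Z /\ x < b' /\ b < d).
  { intros a d x Ha [H1 [H2 H3]] Hx. destruct (H3 x Hx) as [b' [b [Z [K1 K2]]]].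
    apply (Htrip a d Ha H1 H2) in K1 as [K1 K3]. exists b', b, Z. auto. }
  (* The guess is read off the triple with least [b], so that initial segments compute the same set. *)
  set (S := fun a x => unb (Acc a) a /\ x < a /\ exists b0 b' Z, trip a b' b0 Z /\ x < b' /\ Z x /\
    forall b'' b1 Z', trip a b'' b1 Z' -> x < b'' -> b0 <= b1).
  exists (refine C Acc), S.
  pose proof (refine_square C Acc HC Hcoh) as HC2.
  split; [exact HC2|split; [intros a x Hx; apply Hx|split]].
  - intros a d Ha Hd Hlp x.
    pose proof (refine_bounded C Acc a d HC Hcoh Ha Hd Hlp) as Hb.
    assert (Hd1 : C a d) by apply Hd.
    assert (Hd2 : limit_point (C a) d) by (revert Hlp; apply limit_point_sub; intros y Hy; apply Hy).
    specialize (Htrip a d Ha Hd1 Hd2).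
    assert (Hda : d < a) by (apply HC; auto).
    split.
    + intros [K1 [K2 [b0 [b' [Z [K3 [K4 [K5 K6]]]]]]]]. split; auto.
      split; [now apply Hb|]. split; [ord|]. apply Htrip in K3 as [K3 K3'].
      exists b0, b', Z. repeat split; auto; try apply K3.
      intros b'' b1 Z' L1 L2. apply not_lt. intro L3.
      assert (b0 <= b1); [|ord]. apply (K6 b'' b1 Z'); auto. apply Htrip. split; auto. ord.
    + intros [[K1 [K2 [b0 [b' [Z [K3 [K4 [K5 K6]]]]]]]] K7].
      apply Hb in K1. split; auto. split; auto.
      (* An accumulation point [d'] between [x] and [d] provides a proposal about [x] with [b1]
         below [d], so the least [b0] for [a] is below [d] too. *)
      destruct (K1 x K7) as [d' [D1 [D2 D3]]].
      destruct (Htrip_Acc d d' x) as [b'' [b1 [Z' [L1 [L2 L3]]]]]; auto; [apply Hlp|].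
      apply Htrip in L1 as [L1 L4]. specialize (K6 _ _ _ L1 L2) as L5.
      exists b0, b', Z. split; [apply Htrip; split; auto; ord|]. repeat split; auto.
      intros c' c Z'' M1 M2. apply Htrip in M1 as [M1 _]. eauto.
  - intros a G A Ha Huc [Hg1 Hg2].
    assert (Hsub : forall x, C a x -> x < a) by (intro x; apply HC).
    assert (HAcc : unb (Acc a) a).
    { intros y Hy.
      destruct (sequence_limit (fun u v => exists b' Z, u < b' /\ trip a b' v Z) a y Huc Hy)
        as [d [D1 [D2 [D3 D4]]]].
      { intros x Hx. destruct (Hg1 x Hx) as [b' [b [Z [K1 [K2 [K3 K4]]]]]].
        specialize (HRlt _ _ _ _ K4) as L. exists b. repeat split; auto; [|ord].
        exists b', Z. repeat split; auto. }
      assert (Hlp : limit_point (C a) d).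
      { split; auto. intros x Hx. destruct (D4 x Hx) as [u [v [[b' [Z [K1 K2]]] [K3 [K4 K5]]]]].
        exists v. split; [apply K2|]. split; auto. ord. }
      assert (HCd : C a d) by (apply HC; auto).
      exists d. split; auto. split; auto. split; auto.
      intros x Hx. destruct (D4 x Hx) as [u [v [[b' [Z [K1 K2]]] [K3 [K4 K5]]]]].
      exists b', v, Z. split; [|ord]. apply (Htrip a d); auto. }
    assert (HAG : forall d, Acc a d -> closed_under G d).
    { intros d Hd. split; [apply Hd|]. intros x Hx.
      destruct (Htrip_Acc a d x Ha Hd Hx) as [b' [b [Z [[K1 [K2 K3]] [K4 K5]]]]].
      destruct (Hg2 _ _ _ K1 K2 K3) as [[_ L] _]. apply HRlt in K3.
      assert (G x < b) by (apply L; ord). ord. }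
    split; [|split].
    + intros x [_ [[_ [Hx|[Hx1 Hx2]]]|[K _]]]; [auto| |tauto].
      split; auto. intros y Hy. destruct (Hx2 y Hy) as [d [K1 [K2 K3]]].
      apply HAG in K1 as [_ K1]. specialize (K1 y K2). ord.
    + intro x. split.
      * intros [_ [K2 [b0 [b' [Z [K3 [K4 [K5 _]]]]]]]]. split; auto.
        apply (Hg2 b' b0 Z); auto; apply K3.
      * intros [HA Hx]. split; auto. split; auto.
        destruct (wf_min lt (fun b => exists b' Z, trip a b' b Z /\ x < b') lt_wf)
          as [b0 [[b' [Z [K1 K2]]] K3]].
        { destruct (Hg1 x Hx) as [b' [b [Z [? [? [? ?]]]]]]. exists b, b', Z. repeat split; auto. }
        exists b0, b', Z. repeat split; auto; try apply K1.
        -- destruct K1 as [? [? ?]]. apply (Hg2 b' b0 Z); auto.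
        -- intros b'' b1 Z' L1 L2. apply not_lt. intro L3. apply (K3 b1); eauto.
    + intros y Hy. destruct HC2 as [_ HC2]. destruct (HC2 a Ha) as [U1 [U2 _]].
      destruct (sequence_limit (fun u v => refine C Acc a v) a y Huc Hy) as [d [D1 [D2 [D3 D4]]]].
      { intros x Hx. destruct (U1 x Hx) as [v [? [? ?]]]. eauto. }
      assert (Hlp : limit_point (refine C Acc a) d).
      { split; auto. intros x Hx. destruct (D4 x Hx) as [u [v [? [? [? ?]]]]].
        exists v. split; auto. split; auto. ord. }
      exists d. auto 6.
Qed.

(** * The choice of [Gamma] and the division into blocks *)

(* Since [lam] is not the successor of a regular cardinal, these are cofinal among the regular
   cardinals below [lam]: of two consecutive successor cardinals at most one is [cf lam]. *)
Definition candidate (g : T) : Prop :=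
  g < lam /\ is_regular lt g /\ pigeon g /\
  exists b, b < g /\ infinite lt b /\ forall g', is_regular lt g' -> g' < g -> g' < b.

Lemma candidate_cofinal th : ~ succ_of_regular lt lam -> th < lam -> is_regular lt th ->
  exists g, candidate g /\ th < g.
Proof.
  intros Hnsr Hth Hreg.
  destruct (next_regular th Hnsr Hth Hreg) as [g1 [A1 [A2 [A3 A4]]]].
  destruct (next_regular g1 Hnsr A2 A3) as [g2 [B1 [B2 [B3 B4]]]].
  destruct (pigeon_or g1 g2) as [K|K]; eauto using reg_of_regular.
  - exists g1. repeat split; auto; apply A3.
  - exists g2. split; [|ord]. repeat split; auto; apply B3.
Qed.

Lemma candidate_uncountable_cof g a : candidate g -> cf_is lt a g -> uncountable_cof a /\ pigeon a.
Proof.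
  intros [_ [H1 [H2 [b [H3 [H4 _]]]]]] [Hc _]. apply cof_map_iff in Hc as [s Hs]. split.
  - apply (uncountable_cof_cofinal a g s Hs). apply (reg_uncountable_cof g b); auto using reg_of_regular.
  - now apply (pigeon_cofinal a g s).
Qed.

(** Otherwise each [eps] is excluded by some [G eps]. A point of cofinality [g] closed under a
    function dominating them all still has order type below [lam] by [pigeon_otp], a
    contradiction. *)
Lemma stationary_otp C g : is_square C -> candidate g ->
  exists eps, eps < lam /\ forall G, exists a, closed_under G a /\ cf_is lt a g /\ pos (C a) a = eps.
Proof.
  intros [_ HC] Hg. apply NNPP. intro K.
  destruct (choice (fun eps G => eps < lam ->
    forall a, closed_under G a -> cf_is lt a g -> pos (C a) a <> eps)) as [G HG].
  { intro eps. apply NNPP. intro K'. apply K. exists eps. split.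
    - apply NNPP. intro. apply K'. exists (fun x => x). tauto.
    - intro G. apply NNPP. intro K''. apply K'. exists G. intros _ a H1 H2 H3. apply K''. eauto. }
  destruct (dominate_family (below lam) G) as [G' HG']; [now apply emb_incl|].
  destruct (cofinality_stationary g G') as [a [Ha1 Ha2]]; [apply Hg|].
  destruct (HC a) as [H1 [_ [_ H4]]]; [apply Ha1|].
  assert (Hlt : pos (C a) a < lam).
  { apply pigeon_otp; auto. now apply (candidate_uncountable_cof g). }
  apply (HG (pos (C a) a) Hlt a); auto.
  apply closed_under_mono with G'; auto. intro x. left. auto.
Qed.

Lemma diamond_square_exists : ~ succ_of_regular lt lam -> square lt lam -> CH lt lam ->
  exists Gamma : T -> Prop,
    (forall g, Gamma g -> lt g lam /\ is_regular lt g) /\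
    (forall th, lt th lam -> is_regular lt th -> exists g, Gamma g /\ le lt th g) /\
    diamond_square lt lam Gamma.
Proof.
  intros Hnsr [Csq Hsq] Hch. apply is_square_of_square_seq in Hsq.
  set (C := fun a x => Csq a x /\ x < a) in *.
  set (otp := fun a => pos (C a) a).
  destruct (choice (fun g eps => candidate g -> eps < lam /\
    forall G, exists a, closed_under G a /\ cf_is lt a g /\ otp a = eps)) as [eps Heps].
  { intro g. destruct (classic (candidate g)) as [Hg|]; [|exists g; tauto].
    destruct (stationary_otp C g Hsq Hg) as [e He]. eauto. }
  pose proof Hsq as [HCa HC].
  (* [eps g] has cofinality [g], so distinct candidates have distinct [eps]. *)
  assert (Hcof : forall g, candidate g ->
    (exists x, x < eps g) /\ ub g (eps g) /\ forall b, b < g -> ~ ub b (eps g)).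
  { intros g Hg. destruct (Heps g Hg) as [_ K].
    destruct (K (fun x => x)) as [a [[K1 _] [[K2 _] <-]]].
    apply cof_map_iff in K2 as [s Hs]. destruct (HC a K1) as [U _].
    split; [|split].
    - destruct K1 as [[y Hy] _]. destruct (U y Hy) as [x [? [? ?]]].
      exists (pos (C a) x). now apply pos_lt.
    - now apply (ub_otp (C a) a g s).
    - intros b Hb. apply (otp_not_ub (C a) a g s); auto. apply reg_of_regular, Hg. }
  assert (Hinj : forall g g', candidate g -> candidate g' -> g < g' -> eps g <> eps g').
  { intros g g' Hg Hg' K E. apply (proj2 (proj2 (Hcof g' Hg')) g K). rewrite <- E.
    now apply Hcof. }
  (* This restriction makes [eps] strictly increasing on [Gamma]. *)
  set (Gamma := fun g => candidate g /\ forall g', candidate g' -> g < g' -> eps g < eps g').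
  assert (HGinj : forall g g', Gamma g -> Gamma g' -> eps g = eps g' -> g = g').
  { intros g g' [Hg _] [Hg' _] E. destruct (lt_total g g') as [K|[K|K]]; auto;
    apply Hinj in K; auto; congruence. }
  (* Smaller boundaries come from indices below some [b < g], too few to be cofinal in [eps g]; [x0]
     fills in at the other indices. *)
  assert (Hgap : forall g, Gamma g -> exists s, s < eps g /\
    forall g', Gamma g' -> eps g' < eps g -> eps g' < s).
  { intros g [Hg HGg]. destruct (Hcof g Hg) as [[x0 Hx0] [_ Hn]].
    destruct Hg as [_ [_ [_ [b [Hb1 [_ Hb2]]]]]].
    destruct (not_ub b (eps g) (fun x => if excluded_middle_informative (eps x < eps g) then eps x else x0))
      as [s [Hs1 Hs2]]; auto.
    - intros x Hx. destruct (excluded_middle_informative (eps x < eps g)); auto.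
    - exists s. split; auto. intros g' [Hg' HGg'] K.
      assert (g' < b) as L.
      { apply Hb2; [apply Hg'|]. apply NNPP. intro N. apply not_lt in N as [N| <-]; [|ord].
        specialize (HGg g' Hg' N). ord. }
      specialize (Hs2 g' L). destruct (excluded_middle_informative (eps g' < eps g)); [auto|tauto]. }
  (* The block boundaries in [C a]. Refining by them leaves only the last block when they are
     bounded in [a]. *)
  set (F := fun a x => C a x /\ exists g, Gamma g /\ pos (C a) x = eps g).
  assert (HCpos : forall a d, is_limit lt a -> C a d -> limit_point (C a) d ->
    forall x, x <= d -> pos (C d) x = pos (C a) x).
  { intros a d H1 H2 H3 x Hx. destruct (HC a H1) as [_ [_ [Hc _]]].
    apply pos_ext. intros y Hy. rewrite (Hc d H2 H3). split; [tauto|]. intro. split; auto. ord. }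
  assert (HF : coherent C F).
  { split; [intros a x Hx; apply Hx|]. intros a d H1 H2 H3 x. unfold F.
    destruct (HC a H1) as [_ [_ [Hc _]]]. rewrite (Hc d H2 H3). split.
    - intros [[K1 K2] K3]. rewrite (HCpos a d) in K3; auto. now left.
    - intros [[K1 K2] K3]. rewrite (HCpos a d); auto. now left. }
  set (C1 := refine C F).
  pose proof (refine_square C F Hsq HF) as HC1.
  (* The block of [a]; no block is assigned when the block boundaries accumulate at [a]. *)
  set (label := fun a g => Gamma g /\ ~ unb (F a) a /\ otp a <= eps g /\
    forall g', Gamma g' -> otp a <= eps g' -> eps g <= eps g').
  (* When the boundaries are bounded in [a], all of them lie below [d], so no [eps g'] separates the
     order types of [d] and [a]. *)
  assert (Hlabel : forall a d, is_limit lt a -> C1 a d -> limit_point (C1 a) d -> label d = label a).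
  { intros a d H1 H2 H3. pose proof (refine_bounded C F a d Hsq HF H1 H2 H3) as Hb.
    assert (H4 : limit_point (C a) d) by (revert H3; apply limit_point_sub; intros y Hy; apply Hy).
    assert (H5 : C a d) by apply H2.
    extensionality g. apply propositional_extensionality. unfold label. rewrite Hb.
    destruct (classic (unb (F a) a)) as [K|K]; [tauto|].
    assert (Hd : otp d = pos (C a) d) by (apply HCpos; auto using le_refl).
    assert (Heq : forall g', Gamma g' -> (otp d <= eps g' <-> otp a <= eps g')).
    { intros g' Hg'. rewrite Hd. split; intro L.
      - apply not_lt. intro N. apply pos_onto in N as [x [X1 [X2 X3]]].
        assert (F a x) as HFx by (split; eauto).
        destruct H3 as [[[y Hy] _] H3]. destruct (H3 y Hy) as [z [[_ [[? _]|[_ Hz]]] [_ Hzd]]]; [tauto|].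
        specialize (Hz x HFx). assert (x < d) as M by ord.
        apply (pos_lt (C a)) in M; auto. rewrite X3 in M. ord.
      - apply le_trans with (otp a); auto. left. apply pos_lt; auto. }
    split.
    - intros [L1 [L2 [L3 L4]]]. rewrite Heq in L3; auto.
      split; [|split; [|split]]; auto. intros g' Hg' L. apply L4; auto. now apply Heq.
    - intros [L1 [L2 [L3 L4]]]. rewrite Heq; auto.
      split; [|split; [|split]]; auto. intros g' Hg' L. apply L4; auto. now apply Heq. }
  (* By the gap below [eps g], boundaries do not accumulate at a point of order type [eps g]. *)
  assert (Hself : forall a g, Gamma g -> is_limit lt a -> otp a = eps g -> label a g).
  { intros a g Hg Ha E. split; auto. split; [|split; [right; auto|rewrite E; auto]].
    intro K. destruct (Hgap g Hg) as [s [S1 S2]]. rewrite <- E in S1.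
    apply pos_onto in S1 as [x [X1 [X2 X3]]].
    destruct (K x X1) as [y [[Y1 [g' [Y2 Y3]]] [Y4 Y5]]].
    assert (L : eps g' < eps g) by (rewrite <- Y3, <- E; now apply pos_lt).
    specialize (S2 g' Y2 L). apply (pos_lt (C a)) in Y4; auto. rewrite X3, Y3 in Y4. ord. }
  assert (Hfun : forall a g g', label a g -> label a g' -> g = g').
  { intros a g g' [L1 [_ [L2 L3]]] [M1 [_ [M2 M3]]]. apply HGinj; auto.
    apply le_antisym; auto. }
  set (S0 := fun g a => is_limit lt a /\ cf_is lt a g /\ otp a = eps g).
  assert (Hguess : forall g, exists R : T -> T -> (T -> Prop) -> Prop, Gamma g ->
    (forall b' b Z, R b' b Z -> b' < b) /\
    forall G A, exists a, S0 g a /\ guesses (C1 a) R G A a).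
  { intro g. destruct (classic (Gamma g)) as [Hg|]; [|exists (fun _ _ _ => True); tauto].
    destruct (guess_family Hch C1 (S0 g)) as [R HR]; [| |now exists R].
    - intros a [A1 [A2 A3]]. destruct HC1 as [_ HC1]. destruct (HC1 a A1) as [U1 [U2 _]].
      destruct (candidate_uncountable_cof g a) as [V1 V2]; auto; [apply Hg|].
      repeat (split; [assumption|]).
      (* [C1 a] is part of [C a], whose order type is [eps g], and [pos] embeds it. *)
      exists (eps g). split; [apply Heps, Hg|]. exists (pos (C a)). split.
      + intros x Hx. rewrite <- A3. apply pos_lt; [apply HCa|]; apply Hx.
      + intros x y [Hx _] [Hy _] E. destruct (lt_total x y) as [K|[K|K]]; auto;
        apply (pos_lt (C a)) in K; auto; rewrite E in K; ord.
    - intro G. destruct (Heps g) as [_ K]; [apply Hg|].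
      destruct (K G) as [a [K1 [K2 K3]]]. exists a. repeat split; auto; try apply K1; apply K2. }
  apply choice in Hguess as [R HR].
  destruct (diamond_of_guesses C1 (fun a b' b Z => exists g, label a g /\ R g b' b Z))
    as [C2 [S [D1 [D2 [D3 D4]]]]]; auto.
  { intros a b' b Z [g [L K]]. apply HR in K; auto. apply L. }
  { intros a d H1 H2 H3. now rewrite (Hlabel a d H1 H2 H3). }
  exists Gamma. split; [|split].
  - intros g [Hg _]. split; apply Hg.
  - intros th Hth Hreg.
    destruct (candidate_cofinal th Hnsr Hth Hreg) as [g0 Hg0].
    (* Among the candidates above [th], the one with least [eps] is in [Gamma], by injectivity of
       [eps]. *)
    destruct (wf_min (fun g g' => eps g < eps g') (fun g => candidate g /\ th < g)) as [g [[G1 G2] G3]].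
    + apply wf_inverse_image, lt_wf.
    + eauto.
    + exists g. split; [|now left]. split; auto. intros g' Hg' Hlt.
      destruct (not_lt (eps g') (eps g)) as [|E]; auto.
      * apply G3. split; auto. ord.
      * now destruct (Hinj g g' G1 Hg' Hlt).
  - exists C2, S. split; [now apply square_seq_of_is_square|]. split; [auto|]. split.
    + intros a Ha b [Hb1 Hb2] x. apply sup_unb in Hb2.
      destruct (classic (exists y, y < b)) as [He|He].
      * apply D3; auto. split; auto. split; auto.
        intros y Hy. destruct (Hb2 y Hy) as [z [? ?]]. eauto.
      * split; [intro K; apply D2 in K|intros [_ K]]; exfalso; eauto.
    + intros D A th HD Hth _. destruct (club_closed_under D HD) as [G HG].
      destruct (HR th Hth) as [_ HRth]. destruct (HRth G A) as [a [[A1 [A2 A3]] [A4 A5]]].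
      (* At [a] only the guess [R th] is active, since labels are unique. *)
      pose proof (Hself a th Hth A1 A3) as Hla.
      destruct (D4 a G A A1) as [E1 [E2 E3]].
      * apply (candidate_uncountable_cof th); auto. apply Hth.
      * split.
        -- intros x Hx. destruct (A4 x Hx) as [b' [b [Z [? [? [? ?]]]]]]. exists b', b, Z. eauto 7.
        -- intros b' b Z H1 H2 [g [H3 H4]]. rewrite (Hfun a g th H3 Hla) in H4. auto.
      * exists a. split; [auto|]. split; [auto|]. split; [auto|]. split.
        -- intros x [Hx _]. left. now apply D1.
        -- intros b Hb. apply not_lt. intro K. destruct (E3 b K) as [d [[H1 [_ H2]] [H3 H4]]].
           assert (d <= b); [|ord]. apply Hb. split; auto. now apply sup_unb.
Qed.

End WellOrder.

Theorem theorem2p1 (T : Type) (lt : T -> T -> Prop) (lam : T)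
  (Hwo : is_well_order lt)
  (Hsucc : is_succ_type lt lam)
  (Hunc : uncountable lt lam)
  (Hnsr : ~ succ_of_regular lt lam)
  (Hsq : square lt lam)
  (Hch : CH lt lam) :
  exists Gamma : T -> Prop,
    (forall g, Gamma g -> lt g lam /\ is_regular lt g) /\
    (forall th, lt th lam -> is_regular lt th -> exists g, Gamma g /\ le lt th g) /\
    diamond_square lt lam Gamma.
Proof. exact (diamond_square_exists lam Hwo Hsucc Hunc Hnsr Hsq Hch). Qed.
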